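(* Let $\Omega\subseteq\mathbb{R}$ be a compact metric space (with the metric inherited from $\mathbb{R}$), let $\mathcal{B}(\Omega)$ be its Borel $\sigma$-algebra, $\mu$ a probability measure on $\mathcal{B}(\Omega)$, and $T:\Omega\to\Omega$ a $\mathcal{B}(\Omega)$-measurable map with $\mu(T^{-1}(A))=\mu(A)$ for all $A\in\mathcal{B}(\Omega)$. Let $T$ be aperiodic with regard to $\mu$ and countable piecewise monotone, and let $\mathcal{M}$ be a countable partition into monotony intervals of $T$. If the Shannon entropy satisfies $H(\mathcal{M})<\infty$, then the permutation entropy of $T$ equals the Kolmogorov-Sinai entropy of $T$: \[ h^{PE}(T)=h(T). \]
   Context: ''Countable'' means finite or countably infinite. All partitions consist of Borel sets. $T^0(\omega)=\omega$ and $T^t(\omega)=T(T^{t-1}(\omega))$. Aperiodic: $T$ is aperiodic with regard to $\mu$ if $\mu\left(\bigcup_{n=1}^\infty\{\omega\in\Omega \mid T^n(\omega)=\omega\}\right)=0$. Monotony: $T$ is monotone on a set $M\subseteq\Omega$ if either $\omega_1\le\omega_2$ implies $T(\omega_1)\le T(\omega_2)$ for all $\omega_1,\omega_2\in M$, or $\omega_1\le\omega_2$ implies $T(\omega_1)\ge T(\omega_2)$ for all $\omega_1,\omega_2\in M$. $T$ is countable piecewise monotone if there is a countable partition $\mathcal{M}$ of $\Omega$ into intervals of $\mathbb{R}$ (single point sets are allowed as intervals) such that $T$ is monotone on each $M\in\mathcal{M}$. Such an $\mathcal{M}$ is called a partition into monotony intervals of $T$. Continuity of $T$ on these intervals is not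 required. Shannon entropy: for a countable partition $\mathcal{P}=\{P_i\}_{i\in I}$, $H(\mathcal{P})=-\sum_{i\in I}\mu(P_i)\log\mu(P_i)$, with $0\log 0=0$. Kolmogorov-Sinai entropy: for a countable partition $\mathcal{P}=\{P_i\}_{i\in I}$ of $\Omega$, $n\in\mathbb{N}$ and $\boldsymbol{i}=(i_0,\dots,i_{n-1})\in I^n$, put $P(\boldsymbol{i})=\bigcap_{k=0}^{n-1}T^{-k}(P_{i_k})$ and $\mathcal{P}^{(n)}=\{P(\boldsymbol{i})\mid\boldsymbol{i}\in I^n\}$, with $H(\mathcal{P}^{(n)})=-\sum_{\boldsymbol{i}\in I^n}\mu(P(\boldsymbol{i}))\log\mu(P(\boldsymbol{i}))$. Then $h(T,\mathcal{P})=\lim_{n\to\infty}\frac1n H(\mathcal{P}^{(n)})$, and $h(T)=\sup h(T,\mathcal{P})$, where the supremum is over all countable partitions $\mathcal{P}$ with $H(\mathcal{P})<\infty$ (equivalently, over all finite partitions). Permutation entropy: let $\Pi_n$ be the set of all permutations $\pi=(\pi_0,\dots,\pi_{n-1})$ of $\{0,1,\dots,n-1\}$. For $\pi\in\Pi_n$ let \[ P_\pi=\{\omega\in\Omega\mid T^{\pi_0}(\omega)\le T^{\pi_1}(\omega)\le\dots\le T^{\pi_{n-1}}(\omega)\}. \] For aperiodic $T$ the sets $P_\pi$, $\pi\in\Pi_n$, cover $\Omega$ and are pairwise disjoint up to $\mu$-null sets. Put $H(\mathcal{P}_\ast^n)=-\sum_{\pi\in\Pi_n}\mu(P_\pi)\log\mu(P_\pi)$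 and \[ h^{PE}(T)=\liminf_{n\to\infty}\frac1n H(\mathcal{P}_\ast^n). \] *)

(* Defs.v *)
From HB Require Import structures.
From mathcomp Require Import all_boot all_order all_algebra all_fingroup.
From mathcomp Require Import all_classical all_reals all_analysis.

Set Implicit Arguments.
Unset Strict Implicit.
Unset Printing Implicit Defensive.

Import Order.TTheory GRing.Theory Num.Theory.
Import numFieldNormedType.Exports.

Local Open Scope classical_set_scope.
Local Open Scope ring_scope.

(* A dynamical system on a compact set Omega of reals is given by a map
   T : R -> R and a probability measure mu on the Borel sets of R, with
   T(Omega) included in Omega and mu Omega = 1. The Borel sets of Omega are the
   Borel sets of R included in Omega, and the values of T and mu off Omega play
   no role: every set of points below is cut down to Omega. *)

Definition measure_preserving (R : realType) (Omega : set R)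
    (mu : probability R R) (T : R -> R) : Prop :=
  forall A : set R, measurable A -> A `<=` Omega ->
    mu (Omega `&` T @^-1` A) = mu A.

Definition aperiodic (R : realType) (Omega : set R) (mu : probability R R)
    (T : R -> R) : Prop :=
  mu (\bigcup_(n in [set n | (0 < n)%N])
        [set w | Omega w /\ iter n T w = w]) = 0%E.

(* Countable partitions are families indexed by a countType, that is, by a
   finite or countably infinite type; [partition] asks for a disjoint cover by
   nonempty sets. *)
Definition borel_partition (R : realType) (Omega : set R) (I : countType)
    (P : I -> set R) : Prop :=
  partition [set: I] P Omega /\ forall i, measurable (P i).

Definition monotone_on (R : realType) (M : set R) (T : R -> R) : Prop :=
  (forall x y, M x -> M y -> x <= y -> T x <= T y) \/
  (forall x y, M x -> M y -> x <= y -> T y <= T x).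

Definition monotony_partition (R : realType) (Omega : set R) (T : R -> R)
    (I : countType) (M : I -> set R) : Prop :=
  borel_partition Omega M /\
  forall i, is_interval (M i) /\ monotone_on (M i) T.

(* 0 log 0 = 0 because of the factor 0. All terms are nonnegative, so the
   unordered sum [esum] is the sum of the series. The sets P i need not be
   disjoint nor cover the space. *)
Definition entropy (R : realType) (mu : probability R R) (I : choiceType)
    (P : I -> set R) : \bar R :=
  \esum_(i in [set: I]) (- (fine (mu (P i)) * ln (fine (mu (P i)))))%:E.

Definition refinement (R : realType) (Omega : set R) (T : R -> R)
    (I : countType) (P : I -> set R) (n : nat) (i : n.-tuple I) : set R :=
  [set w | Omega w /\ forall k : 'I_n, P (tnth i k) (iter k T w)].

(* The term of index 0 is 0 * H = 0, which does not affect the limit. *)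
Definition partition_entropy (R : realType) (Omega : set R)
    (mu : probability R R) (T : R -> R) (I : countType) (P : I -> set R)
    : \bar R :=
  limn (fun n : nat =>
    ((n%:R^-1)%:E * entropy mu (@refinement R Omega T I P n))%E).

Definition KS_entropy (R : realType) (Omega : set R) (mu : probability R R)
    (T : R -> R) : \bar R :=
  ereal_sup [set h | exists (I : countType) (P : I -> set R),
    [/\ borel_partition Omega P,
        (entropy mu P < +oo)%E
      & h = partition_entropy Omega mu T P]].

Definition ordinal_set (R : realType) (Omega : set R) (T : R -> R) (n : nat)
    (pi : 'S_n) : set R :=
  [set w | Omega w /\
           sorted <=%R [seq iter (pi k) T w | k <- enum 'I_n]].

Definition permutation_entropy (R : realType) (Omega : set R)
    (mu : probability R R) (T : R -> R) : \bar R :=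
  limn_einf (fun n : nat =>
    ((n%:R^-1)%:E * entropy mu (@ordinal_set R Omega T n))%E).

(* Main.v *)
(** Write [X_k = T^k w] and let the order pattern be the comparison matrix of
    [X_0, ..., X_(n-1)]; off a null set it carries the same information as the
    permutation.

    Lower bound. For a partition cut by finitely many thresholds, the order
    pattern together with the number of visits above each threshold determines
    the itinerary of length n, so H(itinerary) <= H(pattern) + O(ln n). Such
    partitions approximate every countable partition of finite entropy.

    Upper bound. On a monotony interval the order of [X_i, X_j] is that of
    [X_(i+1), X_(j+1)], up to reversal. Hence the itinerary with respect to M
    refined by thresholds determines the pattern, up to one bit for each k such
    that X_k lies in the same cell as X_(n-1). By aperiodicity X_0, ..., X_(N-1)
    lie in distinct cells of a fine enough threshold partition, up to small
    probability, so the expected number of these k is at most about n / N.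

    All entropy estimates come from Gibbs' inequality, used through sub-Markov
    kernels ([labelH_chain]). *)
Require Import Defs.
From HB Require Import structures.
From mathcomp Require Import all_boot all_order all_algebra all_fingroup.
From mathcomp Require Import all_classical all_reals all_analysis measurable_realfun.
From mathcomp Require Import ring lra zify.
Import Order.TTheory GRing.Theory Num.Theory.
Import numFieldNormedType.Exports.
Local Open Scope classical_set_scope.
Local Open Scope ring_scope.
Set Implicit Arguments.
Unset Strict Implicit.
Unset Printing Implicit Defensive.

(** * Entropy of countable labels *)

Section labels.
Context d (X : measurableType d).

(** All preimages are required to be measurable, which makes post-composition with any map harmless;
    for countably many letters it is enough to check the fibres. *)
Definition mlabel (A : Type) (f : X -> A) :=
  forall S : set A, measurable (f @^-1` S).

Lemma mlabel_fiber (A : countType) (f : X -> A) :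
  (forall a, measurable (f @^-1` [set a])) -> mlabel f.
Proof.
move=> mf S; rewrite [X in measurable X](_ : _ =
  \bigcup_(a in S) (f @^-1` [set a])); last first.
  apply/seteqP; split => [w Sw|w [a Sa]]; first by exists (f w).
  by rewrite /preimage/= => ->.
rewrite bigcup_mkcond; apply: countable_bigcupT_measurable.
  exact: countableP.
by move=> a; case: ifP.
Qed.

Lemma mlabel_bool (f : X -> bool) : measurable_fun setT f -> mlabel f.
Proof. by move=> mf S; rewrite -[_ @^-1` _]setTI; exact: mf. Qed.

Lemma mlabel_comp (A B : Type) (phi : A -> B) (f : X -> A) :
  mlabel f -> mlabel (phi \o f).
Proof. by move=> mf S; exact: mf (phi @^-1` S). Qed.

Lemma preimage_pair (A B : Type) (f : X -> A) (g : X -> B) a b :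
  (fun w => (f w, g w)) @^-1` [set (a, b)] = f @^-1` [set a] `&` g @^-1` [set b].
Proof.
by apply/seteqP; split => w; rewrite /preimage/=; [case=> -> ->|case=> -> ->].
Qed.

Lemma mlabel_pair (A B : countType) (f : X -> A) (g : X -> B) :
  mlabel f -> mlabel g -> mlabel (fun w => (f w, g w)).
Proof.
move=> mf mg; apply: mlabel_fiber => -[a b].
rewrite preimage_pair; apply: measurableI; [exact: mf|exact: mg].
Qed.

Lemma mlabel_mkseq (A : countType) (f : nat -> X -> A) n :
  (forall k, mlabel (f k)) -> mlabel (fun w => mkseq (f^~ w) n).
Proof.
move=> mf; elim: n => [|n IH].
  apply: mlabel_fiber => a; have [->|a0] := eqVneq a [::].
    by rewrite [X in measurable X](_ : _ = setT)//; apply/seteqP; split.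
  rewrite [X in measurable X](_ : _ = set0)//; apply/seteqP; split => // w /=.
  by move=> e; move: a0; rewrite -e.
under eq_fun do rewrite mkseqS.
exact: (mlabel_comp (fun x => rcons x.1 x.2) (mlabel_pair IH (mf n))).
Qed.

Lemma mlabel_shift (A : Type) (f : X -> A) (T : X -> X) :
  measurable_fun setT T -> mlabel f -> mlabel (f \o T).
Proof.
move=> mT mf S; rewrite comp_preimage -[_ @^-1` _]setTI.
by apply: mT => //; exact: mf.
Qed.

Lemma measurable_fun_label (A : Type) (R : realType) (f : X -> A)
  (g : A -> \bar R) : mlabel f -> measurable_fun setT (fun w => g (f w)).
Proof. by move=> mf _ S _; rewrite setTI; exact: mf (g @^-1` S). Qed.

End labels.

(** * Shannon entropy as expected information *)

Section label_entropy.
Context d (X : measurableType d) (R : realType) (mu : probability X R).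

Definition pr (S : set X) : R := fine (mu S).

Lemma prE S : measurable S -> mu S = (pr S)%:E.
Proof. by move=> mS; rewrite fineK// fin_num_measure. Qed.

Lemma pr_ge0 S : 0 <= pr S. Proof. exact: fine_ge0. Qed.

Lemma pr_le1 S : measurable S -> pr S <= 1.
Proof. by move=> mS; rewrite -lee_fin -prE// probability_le1. Qed.

Lemma le_pr S S' : measurable S -> measurable S' -> S `<=` S' -> pr S <= pr S'.
Proof.
by move=> mS mS' SS'; rewrite -lee_fin -!prE// le_measure ?inE.
Qed.

(** The space is cut along the fibres of [f], numbered by [pickle] so that countable additivity over
    nat applies; a number that codes no letter gives an empty piece. *)
Lemma integral_label (A : countType) (f : X -> A) (g : A -> \bar R) :
  mlabel f -> (forall a, 0 <= g a)%E ->
  (\int[mu]_w g (f w) =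
   \esum_(a in [set: A]) (g a * mu (f @^-1` [set a])))%E.
Proof.
move=> mf g0; pose F n := [set w | pickle (f w) = n].
have mF n : measurable (F n) by exact: mf [set a | pickle a = n].
have UF : \bigcup_n F n = setT.
  by apply/seteqP; split => // w _; exists (pickle (f w)).
have mgf : measurable_fun setT (fun w => g (f w)).
  exact: measurable_fun_label.
rewrite -[in LHS]UF ge0_integral_bigcup//; last 2 first.
- by rewrite UF.
- by move=> i j _ _ [w [<- <-]].
rewrite nneseries_esumT; last by move=> n; apply: integral_ge0.
transitivity (\esum_(n in range (@pickle A)) \int[mu]_(x in F n) g (f x))%E.
  rewrite [RHS]esum_mkcond; apply: eq_esum => n _.
  case: ifPn => // /negP; rewrite inE => nA.
  rewrite [F n](_ : _ = set0) ?integral_set0//.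
  by rewrite -subset0 => w /= e; apply: nA; exists (f w).
rewrite esum_image; last by move=> a b _ _; exact: pcan_inj pickleK a b.
apply: eq_esum => a _.
have -> : F (pickle a) = f @^-1` [set a].
  apply/seteqP; split => w /=; last by move=> <-.
  exact: pcan_inj pickleK _ _.
rewrite -(integral_cst mu (mf [set a]) (g a)).
by apply: eq_integral => w; rewrite inE => /= ->.
Qed.

Lemma esum_pr (A : countType) (f : X -> A) : mlabel f ->
  (\esum_(a in [set: A]) (pr (f @^-1` [set a]))%:E = 1)%E.
Proof.
move=> mf; transitivity (\int[mu]_w (cst 1 (f w)))%E.
  rewrite (integral_label mf (g := cst 1%E))//.
  by apply: eq_esum => a _; rewrite mul1e prE//; exact: mf.
by rewrite (integral_cst mu measurableT 1%E) mul1e; exact: probability_setT.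
Qed.

(** Letters of probability zero contribute nothing to either integral. This is why the kernels below
    have to be controlled only on letters that occur. *)
Lemma le_integral_label (A : countType) (f : X -> A) (g h : A -> R) :
  mlabel f -> (forall a, 0 <= g a) -> (forall a, 0 <= h a) ->
  (forall a, 0 < pr (f @^-1` [set a]) -> g a <= h a) ->
  (\int[mu]_w (g (f w))%:E <= \int[mu]_w (h (f w))%:E)%E.
Proof.
move=> mf g0 h0 gh.
rewrite (integral_label (g := EFin \o g) mf)//.
rewrite (integral_label (g := EFin \o h) mf)//.
apply: le_esum => a _ /=; rewrite prE ?lee_fin; last exact: mf.
have [p0|] := boolP (0 < pr (f @^-1` [set a])).
  by rewrite ler_wpM2r ?pr_ge0// gh.
by rewrite lt_neqAle pr_ge0 andbT negbK => /eqP <-; rewrite !mulr0.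
Qed.

Lemma le1_esum (A : countType) (q : A -> R) : (forall a, 0 <= q a) ->
  (\esum_(a in [set: A]) (q a)%:E <= 1)%E -> forall a, q a <= 1.
Proof.
move=> q0 q1 a; rewrite -lee_fin (le_trans _ q1)//; apply: esum_ge.
exists [set a]; last by rewrite fsbig_set1.
by split.
Qed.

(** This is [ln x <= x - 1] at [x = q a / p a], multiplied by [p a] and summed. Positivity of [q]
    where [p] is positive excludes the junk value of [ln] at 0. *)
Lemma gibbs (A : countType) (p q : A -> R) :
  (forall a, 0 <= p a) -> (forall a, 0 <= q a) ->
  (\esum_(a in [set: A]) (p a)%:E = 1)%E ->
  (\esum_(a in [set: A]) (q a)%:E <= 1)%E ->
  (forall a, 0 < p a -> 0 < q a) ->
  (\esum_(a in [set: A]) (- ln (p a) * p a)%:E <=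
   \esum_(a in [set: A]) (- ln (q a) * p a)%:E)%E.
Proof.
move=> p0 q0 p1 q1 pq.
have nl (r : A -> R) : (forall a, 0 <= r a) ->
    (\esum_(a in [set: A]) (r a)%:E <= 1)%E ->
    forall a, 0 <= - ln (r a) * p a.
  by move=> r0 r1 a; rewrite mulr_ge0// oppr_ge0 ln_le0// (le1_esum r0 r1).
have pge a : 0 <= - ln (p a) * p a by apply: nl => //; rewrite p1.
have qge a : 0 <= - ln (q a) * p a by exact: nl.
(* Adding the total mass to both sides leaves the termwise inequality
   [- ln p * p + p <= - ln q * p + q] between nonnegative terms, so no difference of possibly
   infinite sums appears. *)
rewrite -(@leeD2rE _ 1%E)//.
apply: (@le_trans _ _ (\esum_(a in [set: A]) (- ln (q a) * p a)%:E +
    \esum_(a in [set: A]) (q a)%:E)%E); last by rewrite leeD2l.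
rewrite -[X in (_ + X <= _)%E]p1 -!esumD; try by move=> *; rewrite lee_fin.
apply: le_esum => a _; rewrite -!EFinD lee_fin.
have := p0 a; rewrite le_eqVlt => /predU1P[<-|pa].
  by rewrite !mulr0 !add0r.
have qa := pq _ pa.
have : ln (q a / p a) <= q a / p a - 1.
  have := @le_ln1Dx R (q a / p a - 1).
  rewrite [1 + _](_ : _ = q a / p a); last by ring.
  by apply; rewrite ltrBDl subrr divr_gt0.
rewrite ln_div ?posrE// => /(ler_wpM2r (ltW pa)).
rewrite !mulrBl divfK ?gt_eqF//; lra.
Qed.

Definition info (A : Type) (f : X -> A) (a : A) : R :=
  - ln (pr (f @^-1` [set a])).

(* The Shannon entropy of the partition into the level sets of [f]. *)
Definition labelH (A : Type) (f : X -> A) : \bar R :=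
  (\int[mu]_w (info f (f w))%:E)%E.

Lemma info_ge0 (A : Type) (f : X -> A) a : mlabel f -> 0 <= info f a.
Proof. by move=> mf; rewrite oppr_ge0 ln_le0// pr_le1. Qed.

Lemma labelH_ge0 (A : Type) (f : X -> A) : mlabel f -> (0 <= labelH f)%E.
Proof. by move=> mf; apply: integral_ge0 => w _; rewrite lee_fin info_ge0. Qed.

Lemma labelHE (A : countType) (f : X -> A) : mlabel f ->
  labelH f = \esum_(a in [set: A])
    (- (pr (f @^-1` [set a]) * ln (pr (f @^-1` [set a]))))%:E.
Proof.
move=> mf; rewrite /labelH (integral_label (g := EFin \o info f) mf).
  apply: eq_esum => a _ /=; rewrite prE; last exact: mf.
  by rewrite -EFinM /info mulNr mulrC.
by move=> a; rewrite lee_fin info_ge0.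
Qed.

Lemma labelH_le_cross (A : countType) (f : X -> A) (q : A -> R) : mlabel f ->
  (forall a, 0 <= q a) -> (\esum_(a in [set: A]) (q a)%:E <= 1)%E ->
  (forall a, 0 < pr (f @^-1` [set a]) -> 0 < q a) ->
  (labelH f <= \int[mu]_w (- ln (q (f w)))%:E)%E.
Proof.
move=> mf q0 q1 pq; rewrite /labelH.
rewrite (integral_label (g := EFin \o info f) mf); last first.
  by move=> a; rewrite lee_fin info_ge0.
rewrite (integral_label (g := fun a => (- ln (q a))%:E) mf); last first.
  by move=> a; rewrite lee_fin oppr_ge0 ln_le0// (le1_esum q0).
have := @gibbs A (fun a => pr (f @^-1` [set a])) q (fun=> pr_ge0 _) q0
  (esum_pr mf) q1 pq.
by congr (_ <= _)%E; apply: eq_esum => a _ /=; rewrite prE//; exact: mf.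
Qed.

Lemma pr_gt0_ex N S : measurable N -> measurable S -> pr N = 0 -> 0 < pr S ->
  exists2 w, S w & ~ N w.
Proof.
move=> mN mS N0 S0; apply: contrapT => nex.
have SN : S `<=` N by move=> w Sw; apply: contrapT => nN; apply: nex; exists w.
by have := le_pr mS mN SN; rewrite N0 leNgt S0.
Qed.

(** Off [N], a fibre of [g] is contained in the fibre of [f] that it meets, so the information of
    [f] is pointwise at most that of [g] on every pair of letters of positive probability. *)
Lemma labelH_le_ae (A B : countType) (f : X -> A) (g : X -> B) (N : set X) :
  mlabel f -> mlabel g -> measurable N -> pr N = 0 ->
  (forall w w', ~ N w -> ~ N w' -> g w = g w' -> f w = f w') ->
  (labelH f <= labelH g)%E.
Proof.
move=> mf mg mN N0 fg; have mfg := mlabel_pair mf mg.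
apply: (le_integral_label (g := fun x => info f x.1) (h := fun x => info g x.2)
  mfg) => [a|a|[a b]]; [exact: info_ge0|exact: info_ge0|] => /=.
set fa := f @^-1` [set a]; set gb := g @^-1` [set b].
rewrite preimage_pair -/fa -/gb.
have mfa : measurable fa by exact: mf.
have mgb : measurable gb by exact: mg.
move=> ab0; have [w0 [/= fw0 gw0] nN0] := pr_gt0_ex mN (measurableI _ _ mfa mgb) N0 ab0.
have gb0 : 0 < pr gb.
  by apply: lt_le_trans ab0 _; apply: le_pr => //; exact: measurableI.
have gf : pr gb <= pr fa.
  have muN : mu N = 0%E by rewrite prE// N0.
  rewrite -lee_fin -!prE// -(measureU0 mfa mN muN).
  apply: le_measure; rewrite ?inE//; first exact: measurableU.
  move=> w gw; have [Nw|nNw] := pselect (N w); [by right|left] => /=.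
  by rewrite /fa /= -fw0; apply: fg => //; rewrite gw0; exact: gw.
by rewrite lerN2 ler_ln// posrE// (lt_le_trans gb0).
Qed.

Lemma labelH_le (A B : countType) (f : X -> A) (g : X -> B) :
  mlabel f -> mlabel g -> (forall w w', g w = g w' -> f w = f w') ->
  (labelH f <= labelH g)%E.
Proof.
move=> mf mg fg; apply: (@labelH_le_ae _ _ _ _ set0) => //.
  by rewrite /pr measure0.
by move=> w w' _ _; exact: fg.
Qed.

(** [K a] is a guess of the law of [g] given [f = a]. The weights [q (a, b) = P(f = a) * K a b] have
    total mass at most 1, and in the cross entropy of Gibbs' inequality [- ln q] splits into the
    information of [f] and the cost of the guess. *)
Lemma labelH_chain (A B : countType) (f : X -> A) (g : X -> B)
    (K : A -> B -> R) :
  mlabel f -> mlabel g -> (forall a b, 0 <= K a b) ->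
  (forall a, \esum_(b in [set: B]) (K a b)%:E <= 1)%E ->
  (forall a b, 0 < pr (f @^-1` [set a] `&` g @^-1` [set b]) -> 0 < K a b) ->
  (labelH (fun w => (f w, g w)) <=
   labelH f + \int[mu]_w (- ln (K (f w) (g w)))%:E)%E.
Proof.
move=> mf mg K0 K1 Kp; have mfg := mlabel_pair mf mg.
have Kle a b : K a b <= 1 by apply: (@le1_esum B (K a)).
pose q x := pr (f @^-1` [set x.1]) * K x.1 x.2.
have q0 x : 0 <= q x by rewrite mulr_ge0// pr_ge0.
have pa a b : 0 < pr (f @^-1` [set a] `&` g @^-1` [set b]) ->
    0 < pr (f @^-1` [set a]).
  move=> /lt_le_trans; apply; apply: le_pr => //.
    by apply: measurableI; [exact: mf|exact: mg].
apply: (@le_trans _ _ (\int[mu]_w (- ln (q (f w, g w)))%:E)%E).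
  apply: labelH_le_cross => //.
    rewrite (_ : setT = setT `*`` (fun=> setT)); last by apply/seteqP; split.
    rewrite -(@esum_esum _ _ _ _ _ (fun a b => (q (a, b))%:E))//; last first.
      by move=> *; rewrite lee_fin.
    rewrite -(esum_pr mf); apply: le_esum => a _; rewrite /q /=.
    rewrite -[leRHS]mule1.
    have p0 := pr_ge0 (f @^-1` [set a]).
    apply: (@le_trans _ _ ((pr (f @^-1` [set a]))%:E *
        \esum_(b in [set: B]) (K a b)%:E)%E); last first.
      by rewrite lee_wpmul2l.
    apply: ge_ereal_sup => _ [F [finF _] <-].
    rewrite (eq_fsbigr (fun b => ((pr (f @^-1` [set a]))%:E * (K a b)%:E)%E)).
      rewrite -ge0_mule_fsumr; last by move=> b; rewrite lee_fin.
      rewrite lee_wpmul2l//; apply: esum_ge; exists F => //.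
    by move=> b _; rewrite EFinM.
  move=> [a b]; rewrite preimage_pair /q /= => ab0.
  by rewrite mulr_gt0 ?Kp// (pa a b).
have mln : measurable_fun setT (fun w => (- ln (K (f w) (g w)))%:E).
  exact: (measurable_fun_label (fun x => (- ln (K x.1 x.2))%:E) mfg).
have minf : measurable_fun setT (fun w => (info f (f w))%:E).
  exact: (measurable_fun_label (fun x => (info f x)%:E) mf).
rewrite /labelH -ge0_integralD//; last 2 first.
- by move=> w _; rewrite lee_fin info_ge0.
- by move=> w _; rewrite lee_fin oppr_ge0 ln_le0.
apply: (le_integral_label (g := fun x => - ln (q x))
  (h := fun x => info f x.1 + - ln (K x.1 x.2)) mfg) => [x|x|[a b]].
- by rewrite oppr_ge0 ln_le0// mulr_ile1 ?pr_ge0 ?pr_le1//; exact: mf.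
- by rewrite addr_ge0 ?info_ge0// oppr_ge0 ln_le0.
- rewrite preimage_pair /q /info /= => ab0.
  by rewrite lnM ?posrE ?Kp ?(pa _ _ ab0)// opprD.
Qed.

(** The chain rule is applied one letter at a time, with kernels that look only at [f] and ignore
    the earlier letters. *)
Lemma labelH_mkseq (A B : countType) (f : X -> A) (g : nat -> X -> B)
    (K : nat -> A -> B -> R) n :
  mlabel f -> (forall k, mlabel (g k)) -> (forall k a b, 0 <= K k a b) ->
  (forall k a, \esum_(b in [set: B]) (K k a b)%:E <= 1)%E ->
  (forall k a b, (k < n)%N ->
    0 < pr (f @^-1` [set a] `&` g k @^-1` [set b]) -> 0 < K k a b) ->
  (labelH (fun w => (f w, mkseq (g^~ w) n)) <=
   labelH f + \sum_(k < n) \int[mu]_w (- ln (K k (f w) (g k w)))%:E)%E.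
Proof.
move=> mf mg K0 K1; elim: n => [|n IH] Kp.
  rewrite big_ord0 adde0; apply: labelH_le => //; last by move=> w w' ->.
  by apply: mlabel_pair => //; exact: mlabel_mkseq.
have mfs m : mlabel (fun w => (f w, mkseq (g^~ w) m)).
  by apply: mlabel_pair => //; exact: mlabel_mkseq.
rewrite big_ord_recr /= addeA.
apply: le_trans (leeD2r _ (IH _)); last first.
  by move=> k a b kn; apply: Kp; exact: ltnW.
apply: le_trans (@labelH_chain _ _ _ (g n) (fun x => K n x.1) (mfs n) (mg n)
  _ _ _) => //.
- apply: labelH_le => //; first exact: mlabel_pair.
  by move=> w w'; rewrite !mkseqS => -[-> -> ->].
- move=> [a s] b p0; apply: Kp => //; apply: lt_le_trans p0 _.
  apply: le_pr.
  + by apply: measurableI; [exact: mfs|exact: mg].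
  + by apply: measurableI; [exact: mf|exact: mg].
  + by move=> w [/= [-> _] ->].
Qed.

End label_entropy.

(** * Itineraries *)

(** The limit is the infimum of [u n / n] over positive [n]: divide [n] with remainder by an [N]
    that almost attains it. The constant [C] bounds the contribution of every remainder. *)
Lemma fekete (R : realType) (u : nat -> R) : (forall n, 0 <= u n) ->
  (forall m n, u (m + n)%N <= u m + u n) -> cvgn (fun n => n%:R^-1 * u n).
Proof.
move=> u0 uD; pose S := [set n%:R^-1 * u n | n in [set n | (0 < n)%N]].
have Slb : lbound S 0 by move=> _ [n _ <-]; rewrite mulr_ge0// invr_ge0.
have Sinf : has_inf S.
  by split; [exists (1%:R^-1 * u 1%N); exists 1%N|exists 0].
have uM N q : u (q * N)%N <= q%:R * u N + u 0%N.
  elim: q => [|q IH]; first by rewrite mul0n mul0r add0r.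
  by rewrite mulSn (le_trans (uD _ _))// -natr1; lra.
apply/cvg_ex; exists (inf S); apply/cvgrPdist_le => /= e e0.
have e2 : 0 < e / 2 by rewrite divr_gt0.
have [_ [N /= N0 <-] NS] := inf_adherent e2 Sinf.
pose C := \sum_(r < N) u r + u 0%N.
have uC n : u n <= (n %/ N)%:R * u N + C.
  rewrite {1}(divn_eq n N) (le_trans (uD _ _))//.
  have rN : (n %% N < N)%N by rewrite ltn_mod.
  have : u (n %% N)%N <= \sum_(r < N) u r.
    by rewrite (bigD1 (Ordinal rN))//= lerDl sumr_ge0.
  by have := uM N (n %/ N)%N; rewrite /C; lra.
have C0 : 0 <= C by rewrite addr_ge0// sumr_ge0.
near=> n.
have n0 : (0 < n)%N by near: n; exact: nbhs_infty_gt.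
have nR : 0 < n%:R :> R by rewrite ltr0n.
have NR : 0 < N%:R :> R by rewrite ltr0n.
have Cn : C / n%:R <= e / 2.
  rewrite ler_pdivrMr// mulrC -ler_pdivrMr//.
  by near: n; exact: nbhs_infty_ger.
have SL : inf S <= n%:R^-1 * u n.
  by apply: ge_inf; [exists 0|exists n].
rewrite distrC ger0_norm ?subr_ge0//.
have dn : (n %/ N)%:R <= n%:R / N%:R :> R.
  by rewrite ler_pdivlMr// -natrM ler_nat leq_divM.
have : n%:R^-1 * u n <= N%:R^-1 * u N + C / n%:R.
  rewrite mulrC ler_pdivrMr// mulrDl mulfVK ?gt_eqF//.
  apply: le_trans (uC n) _; rewrite lerD2r.
  apply: le_trans (ler_wpM2r (u0 N) dn) _.
  by rewrite le_eqVlt; apply/orP; left; apply/eqP; ring.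
move: NS Cn; lra.
Unshelve. all: by end_near. Qed.

Section names.
Context d (X : measurableType d) (R : realType) (mu : probability X R).
Variable T : X -> X.
Hypothesis mT : measurable_fun setT T.
Hypothesis Tmu : forall A, measurable A -> mu (T @^-1` A) = mu A.

Lemma measurable_iter k : measurable_fun setT (iter k T).
Proof.
elim: k => [|k IH]; first exact: measurable_id.
exact: (measurableT_comp mT IH).
Qed.

Lemma mlabel_iter (A : Type) (f : X -> A) k :
  mlabel f -> mlabel (fun w => f (iter k T w)).
Proof. exact: mlabel_shift (measurable_iter k). Qed.

Lemma mu_iter k S : measurable S -> mu (iter k T @^-1` S) = mu S.
Proof.
move=> mS; elim: k => [//|k IH].
rewrite [_ @^-1` _](_ : _ = T @^-1` (iter k T @^-1` S)).
  by rewrite Tmu//; rewrite -[_ @^-1` _]setTI; exact: measurable_iter measurableT _ mS.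
by apply/seteqP; split => w; rewrite /preimage/= -iterS iterSr.
Qed.

Lemma integral_iter (A : countType) (f : X -> A) (g : A -> \bar R) k :
  mlabel f -> (forall a, 0 <= g a)%E ->
  (\int[mu]_w g (f (iter k T w)) = \int[mu]_w g (f w))%E.
Proof.
move=> mf g0.
rewrite (integral_label mu (mlabel_iter k mf) g0) (integral_label mu mf g0).
apply: eq_esum => a _; congr (_ * _)%E.
exact: (mu_iter k (mf [set a])).
Qed.

Lemma info_iter (A : countType) (f : X -> A) k a :
  mlabel f -> info mu (fun w => f (iter k T w)) a = info mu f a.
Proof.
move=> mf; rewrite /info /pr; congr (- ln (fine _)).
exact: (mu_iter k (mf [set a])).
Qed.

Lemma labelH_iter (A : countType) (f : X -> A) k :
  mlabel f -> labelH mu (fun w => f (iter k T w)) = labelH mu f.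
Proof.
move=> mf; rewrite /labelH.
under eq_integral => w _ do rewrite info_iter//.
apply: (integral_iter (g := fun a => (info mu f a)%:E)) => // a.
by rewrite lee_fin info_ge0.
Qed.

Lemma labelH_pair (A B : countType) (f : X -> A) (g : X -> B) :
  mlabel f -> mlabel g ->
  (labelH mu (fun w => (f w, g w)) <= labelH mu f + labelH mu g)%E.
Proof.
move=> mf mg.
(* The kernel ignores [f] and guesses by the law of [g]; its expected cost is the entropy of [g]. *)
apply: (labelH_chain (K := fun _ b => pr mu (g @^-1` [set b]))) => //.
- by move=> *; exact: pr_ge0.
- by move=> a; rewrite esum_pr.
- move=> a b /lt_le_trans; apply; apply: le_pr => //.
  by apply: measurableI; [exact: mf|exact: mg].
Qed.

Definition name (A : Type) (p : X -> A) n w := mkseq (fun k => p (iter k T w)) n.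

Lemma mlabel_name (A : countType) (p : X -> A) n :
  mlabel p -> mlabel (name p n).
Proof. by move=> mp; apply: mlabel_mkseq => k; exact: mlabel_iter. Qed.

Lemma nameD (A : Type) (p : X -> A) m n w :
  name p (m + n) w = name p m w ++ name p n (iter m T w).
Proof.
rewrite /name /mkseq iotaD map_cat; congr (_ ++ _).
rewrite addnC iotaDl -map_comp; apply: eq_map => k /=.
by rewrite addnC iterD.
Qed.

Lemma labelH_nameD (A : countType) (p : X -> A) m n : mlabel p ->
  (labelH mu (name p (m + n)) <= labelH mu (name p m) + labelH mu (name p n))%E.
Proof.
move=> mp; have mn k := mlabel_name k mp.
rewrite -(labelH_iter m (mn n)).
apply: le_trans (labelH_pair (mn m) (mlabel_iter m (mn n))).
apply: labelH_le => //; first by apply: mlabel_pair => //; exact: mlabel_iter.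
by move=> w w'; rewrite !nameD => -[-> ->].
Qed.

Lemma labelH_name_lty (A : countType) (p : X -> A) n : mlabel p ->
  (labelH mu p < +oo)%E -> (labelH mu (name p n) < +oo)%E.
Proof.
move=> mp Hp; elim: n => [|n IH].
  by apply: le_lt_trans Hp; apply: labelH_le => //; exact: mlabel_name.
rewrite -addn1; apply: le_lt_trans (labelH_nameD _ _ mp) _.
apply: lte_add_pinfty => //; apply: le_lt_trans Hp; apply: labelH_le => //.
  exact: mlabel_name.
by move=> w w' e; rewrite /name /mkseq /= e.
Qed.

Lemma name_rate_cvg (A : countType) (p : X -> A) : mlabel p ->
  (labelH mu p < +oo)%E ->
  cvgn (fun n => ((n%:R^-1)%:E * labelH mu (name p n))%E).
Proof.
move=> mp Hp; have H0 n : (0 <= labelH mu (name p n))%E.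
  by apply: labelH_ge0; exact: mlabel_name.
have Hfin n : labelH mu (name p n) \is a fin_num.
  by rewrite ge0_fin_numE// labelH_name_lty.
have : cvgn (fun n => n%:R^-1 * fine (labelH mu (name p n))).
  apply: fekete => [n|m n]; first exact: fine_ge0.
  by rewrite -lee_fin EFinD !fineK//; exact: labelH_nameD.
move=> /cvg_ex[l ul]; apply/cvg_ex; exists l%:E.
under eq_fun do rewrite -[labelH _ _]fineK// -EFinM.
by apply: cvg_EFin => //; exact: nearW.
Qed.

(* Given the guess [psi (q w)], the label [p w] is coded by a kernel that puts
   mass [1 - delta] on the guess and [delta] on the law of [p]. *)
Lemma labelH_name_approx (A : countType) (p : X -> A) (e : R) : mlabel p ->
  (labelH mu p < +oo)%E -> 0 < e ->
  exists2 beta : R, 0 < beta &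
    forall (B : countType) (b0 : B) (q : X -> B) (psi : B -> A), mlabel q ->
    pr mu [set w | p w != psi (q w)] < beta ->
    forall n, (labelH mu (name p n) <= labelH mu (name q n) + (n%:R * e)%:E)%E.
Proof.
move=> mp Hp e0.
(* With this [dl], a correct guess costs at most [- ln (1 - dl) = e / 3]. *)
pose dl : R := 1 - expR (- (e / 3)).
have dl1 : 1 - dl = expR (- (e / 3)) by rewrite /dl; ring.
have dl0 : 0 < dl by rewrite subr_gt0 expR_lt1; lra.
have dlt1 : dl < 1 by rewrite -subr_gt0 dl1 expR_gt0.
pose F w := info mu p (p w).
have F0 w : 0 <= F w by exact: info_ge0.
have mF : measurable_fun setT (EFin \o F).
  exact: (measurable_fun_label (fun a => (info mu p a)%:E) mp).
have iF : mu.-integrable setT (EFin \o F).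
  apply/integrableP; split => //.
  by under eq_integral => w _ do rewrite gee0_abs ?lee_fin//.
have [b1 [b10 Fb]] := integral_normr_continuous iF (divr_gt0 e0 (ltr0n _ 3)).
have lnd : 0 <= - ln dl by rewrite oppr_ge0 ln_le0// ltW.
(* A wrong guess costs at most [- ln dl] plus the information of the letter. The second bound keeps
   the first summand below [e / 3] on average, and [b1], from absolute continuity of the integral,
   does so for the other. The added 1 keeps the denominator positive. *)
exists (Num.min b1 (e / 3 / (1 - ln dl))).
  by rewrite lt_min b10/= divr_gt0 ?divr_gt0//; lra.
move=> B b0 q psi mq; set N := [set w | _].
rewrite lt_min => /andP[Nb1 Nb2] n.
have mpq := mlabel_pair mp mq.
have mN : measurable N by exact: (mpq [set x | x.1 != psi x.2]).
pose K b a : R := (1 - dl) * (a == psi b)%:R + dl * pr mu (p @^-1` [set a]).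
have K0 b a : 0 <= K b a by rewrite addr_ge0// mulr_ge0 ?pr_ge0//; lra.
have Kp b a : 0 < pr mu (p @^-1` [set a]) -> 0 < K b a.
  move=> pa; rewrite ltr_wpDl//; last by rewrite mulr_gt0.
  by rewrite mulr_ge0//; lra.
have K1 b : (\esum_(a in [set: A]) (K b a)%:E <= 1)%E.
  under eq_esum do rewrite EFinD.
  rewrite esumD; last 2 first.
  - by move=> a _; rewrite lee_fin mulr_ge0//; lra.
  - by move=> a _; rewrite lee_fin mulr_ge0 ?pr_ge0//; lra.
  have -> : (\esum_(i in [set: A]) ((1 - dl) * (i == psi b)%:R)%:E =
      (1 - dl)%:E)%E.
    transitivity (\esum_(i in [set psi b]) (1 - dl)%:E)%E; last first.
      by rewrite esum_set1// lee_fin; lra.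
    rewrite [RHS]esum_mkcond; apply: eq_esum => a _.
    case: ifPn => [|/negP].
      by rewrite inE => /= ->; rewrite eqxx mulr1.
    by rewrite inE => /= /eqP/negbTE ->; rewrite mulr0.
  have -> : (1 = (1 - dl)%:E + dl%:E :> \bar R)%E.
    by rewrite -EFinD; congr EFin; lra.
  rewrite leeD2l//.
  apply: ge_ereal_sup => _ [G [finG _] <-].
  rewrite (eq_fsbigr (fun a => (dl%:E * (pr mu (p @^-1` [set a]))%:E)%E)).
    rewrite -ge0_mule_fsumr; last by move=> a; rewrite lee_fin pr_ge0.
    rewrite -[leRHS]mule1; apply: lee_wpmul2l; first by rewrite lee_fin ltW.
    by rewrite -(esum_pr mu mp); apply: esum_ge; exists G.
  by move=> a _; rewrite EFinM.
have Kle b a : K b a <= 1 by apply: (@le1_esum R A (K b)).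
have nK b a : 0 <= - ln (K b a) by rewrite oppr_ge0 ln_le0.
have cost : (\int[mu]_w (- ln (K (q w) (p w)))%:E <= e%:E)%E.
  pose h x := e / 3 + (if x.1 != psi x.2 then - ln dl + info mu p x.1 else 0).
  have h0 x : 0 <= h x.
    rewrite addr_ge0//; first by lra.
    by case: ifP => // _; rewrite addr_ge0// info_ge0.
  apply: (@le_trans _ _ (\int[mu]_w (h (p w, q w))%:E)%E).
    apply: (le_integral_label (g := fun x => - ln (K x.2 x.1)) (h := h) mpq).
    - by move=> x; exact: nK.
    - exact: h0.
    - move=> [a b]; rewrite preimage_pair /h /= => ab0.
      have pa0 : 0 < pr mu (p @^-1` [set a]).
        apply: lt_le_trans ab0 _; apply: le_pr => //.
        by apply: measurableI; [exact: mp|exact: mq].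
      case: ifPn => [ap|/negPn/eqP ap].
        apply: (@le_trans _ _ (- ln (dl * pr mu (p @^-1` [set a])))).
          rewrite lerN2 ler_ln ?posrE ?mulr_gt0 ?Kp//.
          by rewrite /K lerDr mulr_ge0//; lra.
        rewrite lnM ?posrE// opprD /info; lra.
      rewrite addr0; apply: (@le_trans _ _ (- ln (1 - dl))).
        rewrite lerN2 ler_ln ?posrE ?Kp//; last by lra.
        by rewrite /K -ap eqxx mulr1 lerDl mulr_ge0 ?pr_ge0// ltW.
      by rewrite dl1 expRK opprK.
  rewrite /h; under eq_integral do rewrite EFinD.
  have mh : measurable_fun setT
      (fun w => (if p w != psi (q w) then - ln dl + F w else 0)%:E).
    exact: (measurable_fun_label (fun x => (if x.1 != psi x.2
      then - ln dl + info mu p x.1 else 0)%:E) mpq).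
  rewrite ge0_integralD//; last 2 first.
  - by move=> w _; rewrite lee_fin; lra.
  - move=> w _ /=; rewrite lee_fin; case: ifP => // _.
    by apply: addr_ge0 => //; exact: info_ge0.
  have -> : (\int[mu]_w (e / 3)%:E = (e / 3)%:E)%E.
    rewrite (integral_cst mu measurableT (e / 3)%:E) -[RHS]mule1.
    by congr (_ * _)%E; exact: probability_setT.
  have -> : (\int[mu]_w (if p w != psi (q w) then - ln dl + info mu p (p w)
       else 0)%:E = \int[mu]_(w in N) ((- ln dl)%:E + (F w)%:E))%E.
    rewrite [RHS]integral_mkcond; apply: eq_integral => w _.
    rewrite /patch; case: ifPn => pw.
      by rewrite mem_set// EFinD.
    by rewrite memNset//= /N/=; exact/negP.
  rewrite ge0_integralD//; last 2 first.
  - by move=> w _; rewrite lee_fin.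
  - exact: measurable_funS mF.
  have -> : (\int[mu]_(w in N) (- ln dl)%:E = (- ln dl * pr mu N)%:E)%E.
    by rewrite (integral_cst mu mN (- ln dl)%:E) EFinM -prE.
  have FN : (\int[mu]_(w in N) (F w)%:E <= (e / 3)%:E)%E.
    have : (mu N < b1%:E)%E by rewrite prE// lte_fin.
    have iN : mu.-integrable N (EFin \o F) by exact: integrableS iF.
    move=> /(Fb N mN)/ltW; rewrite -lee_fin; apply: le_trans.
    rewrite /Rintegral fineK.
      by under [leRHS]eq_integral do rewrite ger0_norm//.
    by apply: integrable_fin_num => //; exact: (integrable_norm iN).
  have lnN : - ln dl * pr mu N <= e / 3.
    rewrite ltr_pdivlMr in Nb2; last by lra.
    have := pr_ge0 mu N; lra.
  apply: (@le_trans _ _ ((e / 3)%:E + ((e / 3)%:E + (e / 3)%:E))%E).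
    by rewrite leeD2l// leeD.
  by rewrite -!EFinD lee_fin; lra.
apply: (@le_trans _ _ (labelH mu (fun w => (name q n w, name p n w)))).
  apply: labelH_le => //; [exact: mlabel_name| |by move=> w w' []].
  by apply: mlabel_pair; exact: mlabel_name.
have mqn := mlabel_name n mq.
(* The [k]-th letter of the [p]-name is guessed from the [k]-th letter of the [q]-name alone; the
   default [b0] is not reached for [k < n]. *)
apply: le_trans (@labelH_mkseq _ _ _ mu _ _ (name q n)
  (fun k w => p (iter k T w)) (fun k s => K (nth b0 s k)) n mqn _ _ _ _) _ => //.
- by move=> k; exact: mlabel_iter.
- move=> k s a _ sa; apply: Kp; apply: lt_le_trans sa _.
  rewrite /pr -[in leRHS](mu_iter k); last exact: mp.
  apply: (@le_pr _ _ _ mu).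
  + by apply: measurableI; [exact: mqn|exact: (mlabel_iter k mp)].
  + exact: (mlabel_iter k mp).
  + by move=> w [].
rewrite leeD2l//.
apply: (@le_trans _ _ (\sum_(k < n) e%:E)%E).
  (* By invariance of the measure, every letter costs as much as the one at time 0. *)
  apply: lee_sum => k _; rewrite (eq_integral (fun w =>
    (- ln (K (q (iter k T w)) (p (iter k T w))))%:E)); last first.
    by move=> w _; rewrite /name nth_mkseq.
  rewrite (integral_iter (f := fun w => (p w, q w))
    (g := fun x => (- ln (K x.2 x.1))%:E))//.
  by move=> x; rewrite lee_fin.
by rewrite sumEFin sumr_const card_ord mulr_natl.
Qed.

End names.

(** * Threshold partitions *)

Section pr_extra.
Context d (X : measurableType d) (R : realType) (mu : probability X R).

Lemma pr_setU S S' : measurable S -> measurable S' ->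
  pr mu (S `|` S') <= pr mu S + pr mu S'.
Proof.
move=> mS mS'; rewrite -lee_fin EFinD -!prE//; last exact: measurableU.
exact: measureU2.
Qed.

Lemma le_pr_setU S S1 S2 : measurable S -> measurable S1 -> measurable S2 ->
  S `<=` S1 `|` S2 -> pr mu S <= pr mu S1 + pr mu S2.
Proof.
move=> mS mS1 mS2 SS; apply: le_trans (pr_setU mS1 mS2).
by apply: le_pr => //; exact: measurableU.
Qed.

Lemma pr_nonincreasing_cvg0 (F : nat -> set X) (e : R) :
  (forall n, measurable (F n)) -> (forall n, F n.+1 `<=` F n) ->
  pr mu (\bigcap_n F n) = 0 -> 0 < e -> exists n, pr mu (F n) < e.
Proof.
move=> mF dF F0 e0.
have mcap : measurable (\bigcap_n F n) by exact: bigcapT_measurable.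
have ndF : nonincreasing_seq F.
  apply/nonincreasing_seqP => n; exact/subsetPset/dF.
have Foo : (mu (F 0%N) < +oo)%E by rewrite prE// ltry.
have : (fun n => mu (F n)) @ \oo --> mu (\bigcap_n F n).
  exact: nonincreasing_cvg_mu Foo mF mcap ndF.
rewrite (_ : mu (\bigcap_n F n) = 0%E); last by rewrite prE// F0.
move=> /fine_cvgP[_] /cvgrPdist_lt /(_ e e0) [n _ /(_ n (leqnn n)) /=].
by rewrite sub0r normrN ger0_norm ?pr_ge0//; exists n.
Qed.

End pr_extra.

(** * Approximation of labels by finitely many thresholds *)

Section cuts.
Context (R : realType) (mu : probability R R).

(** The letter records the position of [w] relative to each threshold, so concatenating lists of
    thresholds amounts to taking the common refinement. *)
Definition cut (c : seq R) (w : R) : seq bool := [seq t <= w | t <- c].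

Lemma cut_cat c1 c2 w : cut (c1 ++ c2) w = cut c1 w ++ cut c2 w.
Proof. exact: map_cat. Qed.

Lemma take_cut c1 c2 w : take (size c1) (cut (c1 ++ c2) w) = cut c1 w.
Proof. by rewrite cut_cat take_size_cat// size_map. Qed.

Lemma drop_cut c1 c2 w : drop (size c1) (cut (c1 ++ c2) w) = cut c2 w.
Proof. by rewrite cut_cat drop_size_cat// size_map. Qed.

Lemma mlabel_cut c : mlabel (cut c).
Proof.
have -> : cut c = (fun w => mkseq (fun k => nth 0 c k <= w) (size c)).
  by apply/funext => w; rewrite /cut -[c in LHS](mkseq_nth 0) -map_comp.
apply: mlabel_mkseq => k; apply: mlabel_bool.
by apply: measurable_fun_ler; [exact: measurable_cst|exact: measurable_id].
Qed.

(** [phi] selects the cells whose union agrees with [A] up to measure [e]. *)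
Definition cut_approx (A : set R) := forall e : R, 0 < e ->
  exists c (phi : seq bool -> bool),
    pr mu [set w | (w \in A) != phi (cut c w)] < e.

Lemma mlabel_in (A : set R) : measurable A -> mlabel (fun w => w \in A).
Proof.
move=> mA; apply: mlabel_fiber => -[].
  rewrite [X in measurable X](_ : _ = A)//; apply/seteqP; split => w.
    by rewrite /preimage/= => /set_mem.
  by rewrite /preimage/= => /mem_set.
rewrite [X in measurable X](_ : _ = ~` A); first exact: measurableC.
apply/seteqP; split => w; rewrite /preimage/=; last exact: memNset.
by move=> /negbT /negP h /mem_set.
Qed.

Lemma mlabel_neq (A B : countType) (p : R -> A) (q : R -> B) (psi : B -> A) :
  mlabel p -> mlabel q -> measurable [set w | p w != psi (q w)].
Proof.
by move=> mp mq; exact: (mlabel_pair mp mq) [set x | x.1 != psi x.2].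
Qed.

Lemma cut_approxU A B : measurable A -> measurable B ->
  cut_approx A -> cut_approx B -> cut_approx (A `|` B).
Proof.
move=> mA mB hA hB e e0; have e2 : 0 < e / 2 by lra.
have [c1 [phi1 h1]] := hA _ e2; have [c2 [phi2 h2]] := hB _ e2.
exists (c1 ++ c2), (fun s => phi1 (take (size c1) s) || phi2 (drop (size c1) s)).
rewrite (splitr e); apply: le_lt_trans (ltrD h1 h2).
have mc := mlabel_cut.
apply: le_pr_setU.
- exact: (@mlabel_neq _ _ _ _ (fun s => phi1 (take (size c1) s) ||
    phi2 (drop (size c1) s)) (mlabel_in (measurableU _ _ mA mB)) (mc _)).
- exact: mlabel_neq (mlabel_in mA) (mc _).
- exact: mlabel_neq (mlabel_in mB) (mc _).
- move=> w /=; rewrite take_cut drop_cut in_setU.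
  have [->|?] := eqVneq (w \in A) (phi1 (cut c1 w)); last by left.
  by have [->|?] := eqVneq (w \in B) (phi2 (cut c2 w)); [rewrite eqxx|right].
Qed.

(** The approximable Borel sets form a sigma-algebra containing the rays [[x, +oo[], which a single
    threshold cuts out exactly. Complements negate [phi], and a countable union is close in measure
    to a finite one. *)
Lemma cut_approx_measurable A : measurable A -> cut_approx A.
Proof.
pose C : set (set R) := [set A | measurable A /\ cut_approx A].
suff : (@ocitv R).-sigma.-measurable `<=` C by move=> h /h[].
rewrite RGenCInfty.measurableE; apply: smallest_sub; last first.
  move=> _ [x ->]; split; first exact: measurable_itv.
  move=> e e0; exists [:: x], (head true).
  rewrite [X in pr _ X](_ : _ = set0) ?/pr ?measure0//.
  rewrite -subset0 => w /=; rewrite (_ : (w \in _) = (x <= w)) ?eqxx//.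
  by apply/idP/idP; rewrite inE /= in_itv/= andbT.
split.
- split => // e e0; exists [::], (fun=> false).
  rewrite [X in pr _ X](_ : _ = set0) ?/pr ?measure0//.
  by rewrite -subset0 => w /=; rewrite in_set0.
- move=> B [mB hB]; split; first by apply: measurableD.
  move=> e /hB [c [phi h]]; exists c, (negb \o phi).
  apply: le_lt_trans h; rewrite setTD; apply: le_pr.
  + exact: (@mlabel_neq _ _ _ _ (negb \o phi) (mlabel_in (measurableC mB))
      (mlabel_cut c)).
  + exact: mlabel_neq (mlabel_in mB) (mlabel_cut c).
  + by move=> w /=; rewrite in_setC; apply: contra => /eqP ->.
- move=> F hF; have mF n : measurable (F n) by have [] := hF n.
  have mU : measurable (\bigcup_n F n) by exact: bigcupT_measurable.
  split => // e e0; have e2 : 0 < e / 2 by lra.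
  pose G n := \big[setU/set0]_(i < n) F i.
  have mG n : measurable (G n) by exact: bigsetU_measurable.
  have hG n : cut_approx (G n).
    rewrite /G; elim: n => [|n IH].
      rewrite big_ord0 => e' e'0; exists [::], (fun=> false).
      rewrite [X in pr _ X](_ : _ = set0) ?/pr ?measure0//.
      by rewrite -subset0 => w /=; rewrite in_set0.
    rewrite big_ord_recr /=; apply: cut_approxU => //; first exact: mG n.
    by have [] := hF n.
  have [n hn] : exists n, pr mu (\bigcup_n F n `\` G n) < e / 2.
    apply: pr_nonincreasing_cvg0 => //.
    + by move=> n; exact: measurableD.
    + move=> n; apply: setDS; rewrite /G big_ord_recr; exact: subsetUl.
    + rewrite (_ : \bigcap_n _ = set0) ?/pr ?measure0//.
      rewrite -subset0 => w h; have [[k _ Fk] _] := h 0%N I.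
      have [_] := h k.+1 I; apply; rewrite /G big_ord_recr; by right.
  have [c [phi h]] := hG n _ e2; exists c, phi.
  rewrite (splitr e); apply: le_lt_trans (ltrD hn h).
  apply: le_pr_setU.
  + exact: mlabel_neq (mlabel_in mU) (mlabel_cut c).
  + exact: measurableD.
  + exact: mlabel_neq (mlabel_in (mG n)) (mlabel_cut c).
  + move=> w /=; have [wG|wG] := pselect (G n w).
      rewrite !mem_set//; first by right.
      exact: bigsetU_bigcup wG.
    have [wU|wU] := pselect ((\bigcup_n F n) w); first by left; split.
    by rewrite (memNset wG) (memNset wU); right.
Qed.

(** Letters with a large code have small total probability. The finitely many others are treated one
    at a time, each by approximating its fibre. *)
Lemma cut_label (A : countType) (p : R -> A) (e : R) : mlabel p -> 0 < e ->
  exists c (psi : seq bool -> A), pr mu [set w | p w != psi (cut c w)] < e.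
Proof.
move=> mp e0; have e2 : 0 < e / 2 by lra.
have mL n : measurable [set w | (n <= pickle (p w))%N].
  exact: mp [set a | (n <= pickle a)%N].
have [n hn] : exists n, pr mu [set w | (n <= pickle (p w))%N] < e / 2.
  apply: pr_nonincreasing_cvg0 => //.
    by move=> n w /=; exact: ltnW.
  rewrite (_ : \bigcap_n _ = set0) ?/pr ?measure0//.
  by rewrite -subset0 => w /(_ (pickle (p w)).+1 I) /=; rewrite ltnn.
have mS m c (psi : seq bool -> A) :
    measurable [set w | (pickle (p w) < m)%N && (p w != psi (cut c w))].
  exact: (mlabel_pair mp (mlabel_cut c))
    [set x | (pickle x.1 < m)%N && (x.1 != psi x.2)].
suff [c [psi h]] : exists c (psi : seq bool -> A),
    pr mu [set w | (pickle (p w) < n)%N && (p w != psi (cut c w))] < e / 2.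
  exists c, psi; rewrite (splitr e); apply: le_lt_trans (ltrD hn h).
  apply: le_pr_setU => //; first exact: (mlabel_neq psi mp (mlabel_cut c)).
  by move=> w /= pw; have [|] := leqP n (pickle (p w)); [left|right].
elim: n {hn} (e / 2) e2 => [|n IH] {e0}e e0.
  exists [::], (fun=> p 0).
  rewrite [X in pr _ X](_ : _ = set0) ?/pr ?measure0//.
  by rewrite -subset0 => w /=.
have e2 : 0 < e / 2 by lra.
have [c2 [psi h2]] := IH _ e2.
have mn : measurable [set w | pickle (p w) = n] by exact: mp [set a | pickle a = n].
have [c1 [phi h1]] := cut_approx_measurable mn e2.
(* The first thresholds test whether the letter has code [n]; if the test fails, the guess for the
   smaller codes is used. *)
exists (c1 ++ c2), (fun s => if phi (take (size c1) s) then odflt (p 0) (unpickle n)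
  else psi (drop (size c1) s)).
rewrite (splitr e); apply: le_lt_trans (ltrD h1 h2); apply: le_pr_setU.
- exact: (mS _ _ (fun s => if phi (take (size c1) s)
    then odflt (p 0) (unpickle n) else psi (drop (size c1) s))).
- exact: mlabel_neq (mlabel_in mn) (mlabel_cut c1).
- exact: mS.
move=> w /=; rewrite take_cut drop_cut ltnS leq_eqVlt.
have [eqn|neqn] := eqVneq (pickle (p w)) n; rewrite /=.
  case: ifP => phw; first by rewrite -eqn pickleK eqxx.
  by move=> _; left => /=; rewrite mem_set// phw.
case: ifP => phw /andP[pn ne]; [left|right] => /=; last by rewrite pn.
by rewrite memNset ?phw//; exact/eqP.
Qed.

(** The rationals in their enumeration by [pickle]. The lists are prefixes of one another, so the
    cells get finer with [m]; a number that codes no rational yields the threshold 0. *)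
Definition rat_cuts m : seq R :=
  mkseq (fun k => if unpickle k is Some q then ratr (q : rat) else 0) m.

Lemma cut_rat_cuts_le m m' x y : (m <= m')%N ->
  cut (rat_cuts m') x = cut (rat_cuts m') y ->
  cut (rat_cuts m) x = cut (rat_cuts m) y.
Proof.
move=> /subnKC <-; rewrite /rat_cuts /mkseq iotaD map_cat !cut_cat.
by move=> /eqP; rewrite eqseq_cat ?size_map// => /andP[/eqP].
Qed.

Lemma cut_rat_neq x y : x != y ->
  exists m, cut (rat_cuts m) x != cut (rat_cuts m) y.
Proof.
wlog xy : x y / x < y.
  move=> h; rewrite neq_lt => /orP[xy|yx].
    by apply: h => //; rewrite lt_eqF.
  by have [|m hm] := h _ _ yx; [rewrite lt_eqF|exists m; rewrite eq_sym].
move=> _; have [q] := rat_in_itvoo xy; rewrite in_itv/= => /andP[xq qy].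
(* This length makes the separating rational [q] the last threshold of the list. *)
exists (pickle q).+1; apply/eqP.
rewrite /rat_cuts mkseqS -cats1 !cut_cat => /eqP.
rewrite eqseq_cat ?size_map// => /andP[_].
by rewrite /= pickleK (ltW qy) leNgt xq.
Qed.

Lemma uniq_cut_rat_cuts (s : seq R) : uniq s ->
  exists m, uniq (map (cut (rat_cuts m)) s).
Proof.
have le_notin m m' x (t : seq R) : (m <= m')%N ->
    cut (rat_cuts m) x \notin map (cut (rat_cuts m)) t ->
    cut (rat_cuts m') x \notin map (cut (rat_cuts m')) t.
  move=> mm'; apply: contra => /mapP[y yt /(cut_rat_cuts_le mm') ->].
  exact: map_f.
have le_uniq m m' (t : seq R) : (m <= m')%N -> uniq (map (cut (rat_cuts m)) t) ->
    uniq (map (cut (rat_cuts m')) t).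
  move=> mm'; elim: t => //= x t IH /andP[xt /IH ->].
  by rewrite (le_notin _ _ _ _ mm' xt).
elim: s => [_|x s IH /= /andP[xs /IH[m1 h1]]]; first by exists 0%N.
have [m2 h2] : exists m, cut (rat_cuts m) x \notin map (cut (rat_cuts m)) s.
  elim: s {IH h1} xs => [_|y s IH]; first by exists 0%N.
  rewrite inE negb_or => /andP[/cut_rat_neq[m hm] /IH[m' hm']].
  exists (maxn m m') => /=; rewrite inE negb_or.
  rewrite (le_notin _ _ _ _ (leq_maxr _ _) hm') andbT.
  by apply: contra hm => /eqP /(cut_rat_cuts_le (leq_maxl _ _)) ->.
exists (maxn m1 m2) => /=.
by rewrite (le_notin _ _ _ _ (leq_maxr _ _) h2) (le_uniq _ _ _ (leq_maxl _ _) h1).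
Qed.

End cuts.

(** * Visits of an orbit to a given cell *)

Section recurrence.
Context d (X : measurableType d) (R : realType) (mu : probability X R).
Variable T : X -> X.
Hypothesis mT : measurable_fun setT T.
Hypothesis Tmu : forall A, measurable A -> mu (T @^-1` A) = mu A.

Lemma mlabel_eq (A : countType) (f g : X -> A) :
  mlabel f -> mlabel g -> measurable [set w | f w == g w].
Proof. by move=> mf mg; exact: (mlabel_pair mf mg) [set x | x.1 == x.2]. Qed.

(* Off the preimage of the set where [name T q N] repeats a letter, the events
   [q (T^(i+k) w) = g w] are pairwise disjoint. *)
Lemma block_recurrence (A : countType) (q g : X -> A) N i :
  mlabel q -> mlabel g ->
  \sum_(k < N) pr mu [set w | q (iter (i + k) T w) == g w] <=
  1 + N%:R * pr mu [set w | ~~ uniq (name T q N w)].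
Proof.
move=> mq mg; set Bad := [set w | ~~ uniq _].
have mBad : measurable Bad by exact: (mlabel_name mT N mq) [set s | ~~ uniq s].
pose D := iter i T @^-1` Bad.
have mD : measurable D.
  by rewrite /D -[_ @^-1` _]setTI; exact: (measurable_iter mT i).
have prD : pr mu D = pr mu Bad by rewrite /pr (mu_iter mT Tmu).
pose E (k : 'I_N) := [set w | q (iter (i + k) T w) == g w].
have mE k : measurable (E k) by exact: mlabel_eq (mlabel_iter mT _ mq) mg.
have mED k : measurable (E k `\` D) by exact: measurableD.
have le k : pr mu (E k) <= pr mu (E k `\` D) + pr mu Bad.
  rewrite -prD; apply: le_pr_setU => // w Ew.
  by have [Dw|nDw] := pselect (D w); [right|left].
apply: le_trans (ler_sum _ (fun k _ => le k)) _.
rewrite big_split /= sumr_const card_ord mulr_natl lerD2r.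
rewrite -lee_fin -sumEFin.
under eq_bigr => k _ do rewrite -prE//.
rewrite -(measure_bigsetU_ord mu xpredT mED).
  by apply: probability_le1; exact: bigsetU_measurable.
move=> k l _ _ [w [[/eqP Ek nD] [/eqP El _]]].
have {nD} : uniq (name T q N (iter i T w)) by apply/negPn/negP => h; exact: nD.
move=> /(uniqP (g w))/(_ (val k) (val l)); rewrite !inE size_mkseq !ltn_ord.
move=> h; apply: val_inj; apply: h => //; rewrite !nth_mkseq//.
by rewrite -!iterD addnC Ek addnC El.
all: exact: ltn_ord.
Qed.

(** The first [n] times are covered by [(n %/ N).+1] blocks of length [N], the last of which may
    overshoot. *)
Lemma sum_recurrence (A : countType) (q g : X -> A) N n : (0 < N)%N ->
  mlabel q -> mlabel g ->
  \sum_(k < n) pr mu [set w | q (iter k T w) == g w] <=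
  (n %/ N).+1%:R * (1 + N%:R * pr mu [set w | ~~ uniq (name T q N w)]).
Proof.
move=> N0 mq mg; set E := fun k => _; set b := 1 + _.
have h J : \sum_(k < J * N) pr mu [set w | q (iter k T w) == g w] <= J%:R * b.
  elim: J => [|J IH]; first by rewrite mul0n big_ord0 mul0r.
  rewrite mulSn addnC big_split_ord /= -natr1 mulrDl mul1r lerD//.
  exact: block_recurrence.
apply: le_trans (h (n %/ N).+1).
have nJ : (n <= (n %/ N).+1 * N)%N.
  by rewrite mulSn {1}(divn_eq n N) addnC leq_add2r ltnW// ltn_mod.
rewrite -(subnKC nJ) big_split_ord /= lerDl sumr_ge0// => k _.
exact: pr_ge0.
Qed.

End recurrence.

(** Off [N0] the first [N] points of an orbit are distinct, so some rational cut separates them, and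
    the sets where a letter repeats shrink to a null set. The thresholds do not depend on [n] or
    [g], so [g] may later be the cell of the last point of the orbit segment. *)
Lemma cut_recurrence (R : realType) (mu : probability R R) (T : R -> R)
    (N0 : set R) (e : R) :
  measurable_fun setT T ->
  (forall A, measurable A -> mu (T @^-1` A) = mu A) ->
  measurable N0 -> pr mu N0 = 0 ->
  (forall w, ~ N0 w -> injective (fun k => iter k T w)) -> 0 < e ->
  exists c n0, forall n (g : R -> seq bool), mlabel g -> (n0 <= n)%N ->
    \sum_(k < n) pr mu [set w | cut c (iter k T w) == g w] <= n%:R * e.
Proof.
move=> mT Tmu mN0 N00 Tinj e0.
(* The 4 is 2 for the bound on one block, once a repetition has probability below [1 / N], times 2
   for rounding up the number of blocks when [N <= n]. *)
pose N := (Num.truncn (4 / e)).+1.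
have N0' : (0 < N)%N by [].
have NR : 0 < N%:R :> R by rewrite ltr0n.
have Ne : 4 / N%:R <= e.
  rewrite ler_pdivrMr// mulrC -ler_pdivrMr//.
  by rewrite ltW// truncnS_gt.
pose F m := [set w | ~~ uniq (name T (cut (rat_cuts R m)) N w)].
have [m Fm] : exists m, pr mu (F m) < N%:R^-1.
  apply: pr_nonincreasing_cvg0; last by rewrite invr_gt0.
  - move=> m; exact: (mlabel_name mT N (mlabel_cut (rat_cuts R m)))
      [set s | ~~ uniq s].
  - move=> m w /=; apply: contra => /(uniqP [::]) u; apply/(uniqP [::]).
    move=> i j; rewrite !inE !size_mkseq => iN jN; rewrite !nth_mkseq// => ij.
    apply: u; rewrite ?inE ?size_mkseq// !nth_mkseq//.
    exact: cut_rat_cuts_le (leqnSn m) ij.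
  - apply/eqP; rewrite eq_le pr_ge0 andbT -N00; apply: le_pr => //.
      apply: bigcapT_measurable => m.
      exact: (mlabel_name mT N (mlabel_cut (rat_cuts R m))) [set s | ~~ uniq s].
    move=> w Fw; apply: contrapT => /Tinj inj.
    have : uniq (mkseq (fun k => iter k T w) N).
      by rewrite map_inj_uniq ?iota_uniq.
    move=> /uniq_cut_rat_cuts[m]; have /negP := Fw m I; apply: contra_not.
    by rewrite -map_comp.
exists (rat_cuts R m), N => n g mg nN.
apply: le_trans (sum_recurrence mT Tmu n N0' (mlabel_cut _) mg) _.
have h : 1 + N%:R * pr mu (F m) <= 2.
  rewrite (_ : 2 = 1 + N%:R * N%:R^-1); last by rewrite mulfV ?gt_eqF//.
  by rewrite lerD2l ler_wpM2l// ltW.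
apply: le_trans (ler_wpM2l _ h) _ => //.
have : (n %/ N).+1%:R <= 2 * (n%:R / N%:R) :> R.
  have h1 : (n %/ N)%:R <= n%:R / N%:R :> R.
    by rewrite ler_pdivlMr// -natrM ler_nat leq_divM.
  have h2 : 1 <= n%:R / N%:R :> R by rewrite ler_pdivlMr// mul1r ler_nat.
  rewrite -natr1; lra.
move=> h2; apply: (@le_trans _ _ (n%:R * (4 / N%:R))).
  apply: le_trans (ler_wpM2r _ h2) _ => //.
  by rewrite le_eqVlt; apply/orP; left; apply/eqP; ring.
by rewrite ler_wpM2l.
Qed.

(** * Order patterns *)

Lemma esum_finType (R : realType) (B : finType) (f : B -> \bar R) :
  (forall b, 0 <= f b)%E ->
  (\esum_(b in [set: B]) f b = \sum_(b : B) f b)%E.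
Proof.
move=> f0; rewrite esum_fset//; last exact: finite_finset.
rewrite (fsbig_seq _ f (index_enum_uniq B)); apply: eq_fsbigl.
by apply/seteqP; split => b //= _; exact: mem_index_enum.
Qed.

(** If [x < t], then every entry above [t] is also above [x], while [x] itself is counted only for
    the threshold [x]; so that count is strictly larger. *)
Lemma le_count_threshold (R : realDomainType) (s : seq R) x t : x \in s ->
  (t <= x) =
  (count (fun y => x <= y)%R s <= count (fun y => t <= y)%R s)%N.
Proof.
move=> xs; apply/idP/idP => [tx|].
  by apply: sub_count => y /=; exact: le_trans.
apply: contraTT; rewrite -ltNge -ltnNge => xt.
have /seq.permP e := perm_to_rem xs; rewrite !e /= lexx leNgt xt add0n add1n ltnS.
by apply: sub_count => y /=; apply: le_trans; exact: ltW.
Qed.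

(** If the order of the two intervals were reversed at the primed points, convexity would put [y] in
    [A] or [x'] in [B], against disjointness. *)
Lemma interval_cells_le (R : realDomainType) (A B : set R) x y x' y' :
  is_interval A -> is_interval B -> A `&` B = set0 ->
  A x -> B y -> A x' -> B y' -> x <= y -> x' <= y'.
Proof.
move=> iA iB AB Ax By Ax' By' xy; rewrite leNgt; apply/negP => y'x'.
have nAB z : A z -> B z -> False by move=> Az Bz; rewrite -[False]/(set0 z) -AB.
have [yx'|x'y] := leP y x'.
  by apply: (nAB y) => //; apply: (iA x x') => //; rewrite xy.
by apply: (nAB x') => //; apply: (iB y' y) => //; rewrite !ltW.
Qed.

Lemma integral_if (d : measure_display) (X : measurableType d) (R : realType)
    (mu : probability X R) (P : X -> bool) (r : R) :
  measurable [set w | P w] ->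
  (\int[mu]_w (if P w then r else 0)%:E = (r * pr mu [set w | P w])%:E)%E.
Proof.
move=> mP; rewrite EFinM -prE// -(integral_cst mu mP r%:E).
rewrite [RHS]integral_mkcond; apply: eq_integral => w _; rewrite /patch.
by case: ifPn => Pw; [rewrite mem_set|rewrite memNset//; exact/negP].
Qed.

Section ordinal.
Context (R : realType) (mu : probability R R) (T : R -> R).
Hypothesis mT : measurable_fun setT T.
Hypothesis Tmu : forall A, measurable A -> mu (T @^-1` A) = mu A.

Definition cmp n w : seq (seq bool) :=
  mkseq (fun i => mkseq (fun j => iter i T w <= iter j T w) n) n.

Lemma mlabel_cmp n : mlabel (cmp n).
Proof.
apply: mlabel_mkseq => i; apply: mlabel_mkseq => j; apply: mlabel_bool.
by apply: measurable_fun_ler; exact: measurable_iter.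
Qed.

Lemma nth_cmp n w i j : (i < n)%N -> (j < n)%N ->
  nth false (nth [::] (cmp n w) i) j = (iter i T w <= iter j T w).
Proof. by move=> ? ?; rewrite !nth_mkseq. Qed.

Lemma cmpP n w w' : cmp n w = cmp n w' <-> (forall i j, (i < n)%N -> (j < n)%N ->
  (iter i T w <= iter j T w) = (iter i T w' <= iter j T w')).
Proof.
split=> [e i j ? ?|e]; first by rewrite -!(@nth_cmp n)// e.
apply: (@eq_from_nth _ [::]); rewrite ?size_mkseq// => i iN.
rewrite !nth_mkseq//; apply: (@eq_from_nth _ false); rewrite ?size_mkseq// => j jN.
by rewrite !nth_mkseq// e.
Qed.

(** The bounded type leaves [n.+1] possible values, so a uniform guess of the count costs
    [ln n.+1]. *)
Definition hits (t : R) n w : 'I_n.+1 :=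
  inord (count id (name T (fun x => t <= x) n w)).

Lemma mlabel_hits t n : mlabel (hits t n).
Proof.
apply: (@mlabel_comp _ _ _ _ (fun s => inord (count id s) : 'I_n.+1)).
apply: (mlabel_name mT); apply: mlabel_bool.
by apply: measurable_fun_ler; [exact: measurable_cst|exact: measurable_id].
Qed.

Lemma hitsE t n w : hits t n w =
  count (fun y => t <= y) (name T id n w) :> nat.
Proof.
rewrite /hits inordK; first by rewrite !count_map.
by rewrite ltnS (leq_trans (count_size _ _))// size_mkseq.
Qed.

(* A threshold [t] lies below [X_k] iff at least as many of the [X_l] lie above
   [t] as lie above [X_k], so the order pattern and one count per threshold
   recover the itinerary. *)
Lemma labelH_cut_le_cmp c n :
  (labelH mu (name T (cut c) n) <=
   labelH mu (cmp n) + ((size c)%:R * ln n.+1%:R)%:E)%E.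
Proof.
pose g k := hits (nth 0 c k) n.
have mc := mlabel_cmp n; have mg k : mlabel (g k) by exact: mlabel_hits.
apply: (@le_trans _ _ (labelH mu (fun w => (cmp n w, mkseq (g^~ w) (size c))))).
  apply: labelH_le.
  - by apply: (mlabel_name mT); exact: mlabel_cut.
  - by apply: mlabel_pair => //; exact: mlabel_mkseq.
  move=> w w' [/cmpP ecmp eg].
  apply: (@eq_from_nth _ [::]); rewrite ?size_mkseq// => k kn.
  rewrite !nth_mkseq//; apply: (@eq_from_nth _ false); rewrite !size_map// => j jc.
  rewrite !(nth_map 0)//.
  have mem v : iter k T v \in name T id n v.
    by apply/mapP; exists k => //; rewrite mem_iota.
  rewrite !(le_count_threshold _ (mem _)).
  have -> : count (fun y => iter k T w <= y) (name T id n w) =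
            count (fun y => iter k T w' <= y) (name T id n w').
    rewrite !count_map; apply: eq_in_count => l; rewrite mem_iota => /= lt_ln.
    exact: ecmp.
  have /(congr1 (@nat_of_ord _)) : g j w = g j w'.
    have := congr1 (fun s => nth ord0 s j) eg.
    by rewrite !nth_mkseq.
  by rewrite !hitsE => ->.
pose K (_ : nat) (_ : seq (seq bool)) (_ : 'I_n.+1) : R := n.+1%:R^-1.
have K0 : 0 < n.+1%:R^-1 :> R by rewrite invr_gt0.
apply: le_trans (@labelH_mkseq _ _ _ mu _ _ (cmp n) g K (size c) mc mg _ _ _) _.
- by move=> *; exact: ltW.
- move=> k a; rewrite esum_finType; last by move=> *; rewrite lee_fin ltW.
  rewrite sumEFin sumr_const card_ord lee_fin -[X in X <= _]mulr_natl.
  by rewrite mulfV// pnatr_eq0.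
- by [].
rewrite leeD2l//.
rewrite (eq_bigr (fun=> (ln n.+1%:R : R)%:E)); last first.
  move=> k _; rewrite /K lnV ?posrE ?ltr0n// opprK.
  rewrite (integral_cst mu measurableT (ln n.+1%:R)%:E) -[RHS]mule1.
  by congr (_ * _)%E; exact: probability_setT.
by rewrite sumEFin sumr_const card_ord mulr_natl.
Qed.

Variables (Omega N0 : set R).
Hypothesis mN0 : measurable N0.
Hypothesis N00 : pr mu N0 = 0.
Hypothesis N0C : ~` N0 `<=` Omega.
Hypothesis TOmega : forall w, Omega w -> Omega (T w).
Hypothesis Tinj : forall w, ~ N0 w -> injective (fun k => iter k T w).

Lemma Omega_iter k w : Omega w -> Omega (iter k T w).
Proof. by move=> Ow; elim: k => //= k; exact: TOmega. Qed.

Variables (I : countType) (m : R -> I).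
Hypothesis mm : mlabel m.
Let cell i := [set w | Omega w /\ m w = i].
Hypothesis cell_interval : forall i, is_interval (cell i).
Hypothesis cell_monotone : forall i, monotone_on (cell i) T.

Let p c w := (m w, cut c w).

Lemma cells_le c x y x' y' : Omega x -> Omega y -> Omega x' -> Omega y' ->
  p c x = p c x' -> p c y = p c y' -> p c x != p c y -> x <= y -> x' <= y'.
Proof.
move=> Ox Oy Ox' Oy' [mx cx] [my cy]; rewrite xpair_eqE negb_and => /orP[mxy|cxy].
  apply: (@interval_cells_le _ (cell (m x)) (cell (m y))) => //.
  rewrite -subset0 => z [[_ zx] [_ zy]].
  by move: mxy; rewrite -zx -zy eqxx.
(* If [y' < x'], the thresholds below [y] are those below [y'], hence among those below [x'], which
   are those below [x]; with [x <= y] the two cuts coincide. *)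
move=> xy; rewrite leNgt; apply/negP => y'x'; move/negP: cxy; apply.
apply/eqP/eq_in_map => t tc.
have ex v v' : cut c v = cut c v' -> (t <= v) = (t <= v').
  by move=> /eq_in_map; apply.
apply/idP/idP => [tx|]; first exact: le_trans xy.
rewrite (ex _ _ cy) (ex _ _ cx) => ty'.
exact: le_trans ty' (ltW y'x').
Qed.

Lemma cells_leE c x y x' y' : Omega x -> Omega y -> Omega x' -> Omega y' ->
  p c x = p c x' -> p c y = p c y' -> p c x != p c y -> (x <= y) = (x' <= y').
Proof.
move=> Ox Oy Ox' Oy' px py pxy; apply/idP/idP; first exact: (cells_le (c := c)).
by apply: (cells_le (c := c)) => //; rewrite -px -py.
Qed.

(** Between points with distinct images a monotone map also reflects the order; a decreasing map
    negates both comparisons alike, so their equality survives. *)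
Lemma monotone_leE i x y x' y' : cell i x -> cell i y -> cell i x' -> cell i y' ->
  T x != T y -> T x' != T y' -> (T x <= T y) = (T x' <= T y') ->
  (x <= y) = (x' <= y').
Proof.
move=> ix iy ix' iy' nT nT' eT; case: (cell_monotone i) => mono.
  have le u v : cell i u -> cell i v -> T u != T v -> (u <= v) = (T u <= T v).
    move=> iu iv ne; apply/idP/idP => [uv|]; first exact: mono.
    apply: contraTT; rewrite -!ltNge => vu.
    by rewrite lt_neqAle eq_sym ne/=; apply: mono => //; exact: ltW.
  by rewrite (le x y)// (le x' y').
have le u v : cell i u -> cell i v -> T u != T v -> (u <= v) = ~~ (T u <= T v).
  move=> iu iv ne; rewrite -ltNge; apply/idP/idP => [uv|].
    by rewrite lt_neqAle eq_sym ne/=; exact: mono.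
  apply: contraTT; rewrite -leNgt -ltNge => vu.
  by apply: mono => //; exact: ltW.
by rewrite (le x y)// (le x' y')// eT.
Qed.

(** The bit compares [X_k] with [X_(n-1)] only if they share a cell. Otherwise it is false, hence
    determined by the itinerary and free of cost. *)
Definition tie c n k w :=
  (p c (iter k T w) == p c (iter n.-1 T w)) && (iter k T w <= iter n.-1 T w).

(* Within a monotony interval the order of [X_i, X_j] is that of
   [X_(i+1), X_(j+1)], up to reversal; so the itinerary reduces every
   comparison to one with the last point [X_(n-1)]. *)
Lemma cmp_determined c n w w' : ~ N0 w -> ~ N0 w' ->
  name T (p c) n w = name T (p c) n w' ->
  mkseq (fun k => tie c n k w) n = mkseq (fun k => tie c n k w') n ->
  cmp n w = cmp n w'.
Proof.
move=> Nw Nw' en et; apply/cmpP.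
have Ow k : Omega (iter k T w) by apply: Omega_iter; exact: N0C.
have Ow' k : Omega (iter k T w') by apply: Omega_iter; exact: N0C.
have ep k : (k < n)%N -> p c (iter k T w) = p c (iter k T w').
  move=> kn; have := congr1 (fun s => nth (p c 0) s k) en.
  by rewrite !nth_mkseq.
have eb k : (k < n)%N -> tie c n k w = tie c n k w'.
  move=> kn; have := congr1 (fun s => nth false s k) et.
  by rewrite !nth_mkseq.
have neq v i j : ~ N0 v -> i != j -> iter i T v != iter j T v.
  by move=> /Tinj vi; apply: contra => /eqP/vi ->.
(* Induction on the distance of [j] to the last time. Points in distinct cells are ordered like
   their cells; points in one cell are compared through [i.+1] and [j.+1], and [tie] settles the
   case [j = n.-1]. *)
have lt d i j : (i < j)%N -> (j < n)%N -> (n.-1 - j)%N = d ->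
    (iter i T w <= iter j T w) = (iter i T w' <= iter j T w').
  elim: d i j => [|d IH] i j ij jn dE.
    have jE : j = n.-1 by lia.
    have i_n : (i < n)%N by lia.
    have n1 : (n.-1 < n)%N by lia.
    have [pij|pij] := eqVneq (p c (iter i T w)) (p c (iter j T w)).
      have := eb i i_n; rewrite /tie -jE pij eqxx /= => ->.
      by rewrite -ep// pij -(ep j)// eqxx.
    by apply: (cells_leE (c := c)) => //; apply: ep.
  have i_n : (i < n)%N by lia.
  have [pij|pij] := eqVneq (p c (iter i T w)) (p c (iter j T w)); last first.
    by apply: (cells_leE (c := c)) => //; apply: ep.
  have mi : m (iter i T w') = m (iter i T w) by have [] := ep i i_n.
  have mj : m (iter j T w') = m (iter i T w).
    by case: pij => -> _; have [] := ep j jn.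
  have mj' : m (iter j T w) = m (iter i T w) by case: pij.
  apply: (@monotone_leE (m (iter i T w))) => //.
  - by apply: (neq w i.+1 j.+1 Nw); lia.
  - by apply: (neq w' i.+1 j.+1 Nw'); lia.
  - by apply: (IH i.+1 j.+1); lia.
move=> i j i_n jn; have [ij|ji|->] := ltngtP i j; last by rewrite !lexx.
  exact: lt.
have ge v : ~ N0 v -> (iter i T v <= iter j T v) = ~~ (iter j T v <= iter i T v).
  move=> Nv; rewrite -ltNge lt_neqAle neq//; lia.
by rewrite !ge// (lt _ j i ji i_n erefl).
Qed.

Lemma labelH_cmp_le c n :
  (labelH mu (cmp n) <= labelH mu (name T (p c) n) +
   (ln 2 * \sum_(k < n)
     pr mu [set w | cut c (iter k T w) == cut c (iter n.-1 T w)])%:E)%E.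
Proof.
have mp : mlabel (p c) by apply: mlabel_pair => //; exact: mlabel_cut.
have mpn := mlabel_name mT n mp.
have mpk k : mlabel (fun w => p c (iter k T w)) by exact: mlabel_iter.
have mt k : mlabel (tie c n k).
  apply: mlabel_bool; apply: measurable_and.
    move=> _ S mS; rewrite setTI.
    exact: (mlabel_pair (mpk k) (mpk n.-1)) [set x | S (x.1 == x.2)].
  by apply: measurable_fun_ler; exact: measurable_iter.
apply: (@le_trans _ _ (labelH mu (fun w => (name T (p c) n w,
    mkseq (fun k => tie c n k w) n)))).
  apply: labelH_le_ae mN0 N00 _ => //; first exact: mlabel_cmp.
    by apply: mlabel_pair => //; exact: (mlabel_mkseq (f := tie c n)).
  by move=> w w' Nw Nw' []; exact: cmp_determined.
(* A fair coin if the itinerary puts [X_k] in the cell of the last point, and certainty of [false]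
   otherwise. *)
pose K k (s : seq (I * seq bool)) (b : bool) : R :=
  if nth (p c 0) s k == nth (p c 0) s n.-1 then 2^-1 else (~~ b)%:R.
apply: le_trans (@labelH_mkseq _ _ _ mu _ _ (name T (p c) n) (tie c n)
  K n mpn mt _ _ _) _.
- by move=> k s b; rewrite /K; case: ifP => // _; rewrite invr_ge0.
- move=> k s; rewrite esum_finType; last first.
    by move=> b; rewrite /K; case: ifP => _; rewrite lee_fin// invr_ge0.
  rewrite sumEFin lee_fin big_bool /= /K; case: ifP => _ /=; lra.
- move=> k s b kn sb; rewrite /K; case: ifPn => [_|sk]; first by rewrite invr_gt0.
  have [w [/= ws wb] _] : exists2 w, ((name T (p c) n @^-1` [set s]) `&`
      (tie c n k @^-1` [set b])) w & ~ (set0 : set R) w.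
    apply: (@pr_gt0_ex _ _ _ mu) sb => //; last by rewrite /pr measure0.
    by apply: measurableI; [exact: mpn|exact: mt].
  move: wb sk; rewrite /tie -ws !nth_mkseq//; last by lia.
  by move=> <- /negbTE ->; rewrite ltr01.
rewrite leeD2l// mulr_sumr -sumEFin; apply: lee_sum => k _.
have mE (A : countType) (f : nat -> R -> A) : (forall k, mlabel (f k)) ->
    measurable [set w | f k w == f n.-1 w].
  by move=> mf; exact: mlabel_eq.
apply: (@le_trans _ _ (\int[mu]_w
    (if p c (iter k T w) == p c (iter n.-1 T w) then ln 2 else 0)%:E)%E).
  rewrite le_eqVlt; apply/orP; left; apply/eqP; apply: eq_integral => w _.
  have kn := ltn_ord k; rewrite /K !nth_mkseq//; last by lia.
  rewrite /tie; case: ifP => h /=; first by rewrite lnV ?posrE// opprK.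
  by rewrite [_ == _]h ln1 oppr0.
rewrite integral_if; last exact: (mE _ (fun k w => p c (iter k T w))).
rewrite lee_fin ler_wpM2l//; first by rewrite ln_ge0// ler1n.
(* Sharing a cell of [p c] implies sharing the coarser cell of [cut c]. *)
apply: le_pr.
- exact: (mE _ (fun k w => p c (iter k T w))).
- apply: (mE _ (fun k w => cut c (iter k T w))) => j.
  by apply: mlabel_iter => //; exact: mlabel_cut.
- by move=> w /= /eqP[_ ->].
Qed.

End ordinal.

(** * Permutation entropy and Kolmogorov-Sinai entropy *)

Section limits.
Local Open Scope ereal_scope.
Context (R : realType).
Implicit Types u v : (\bar R)^nat.

Lemma le_limn_einf u v : (\forall n \near \oo, u n <= v n) ->
  limn_einf u <= limn_einf v.
Proof.
move=> [N _ uv]; rewrite !limn_einf_lim.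
apply: lee_lim; [exact: is_cvg_einfs|exact: is_cvg_einfs|].
exists N => // n /= Nn; apply: le_ereal_inf_tmp => _ [k /= nk <-].
apply: le_trans (uv k (leq_trans Nn nk)).
by apply: ereal_inf_lbound; exists k.
Qed.

Lemma cvg_le_limn_einf u v h : u @ \oo --> h ->
  (forall e : R, (0 < e)%R -> \forall n \near \oo, u n <= v n + e%:E) ->
  h <= limn_einf v.
Proof.
move=> uh uv; apply/lee_addgt0Pr => e e0; have [<- _] := cvg_limn_einf_sup uh.
rewrite addeC -limn_einf_shift//; apply: le_limn_einf.
by move: (uv e e0); apply: filterS => n; rewrite addeC.
Qed.

Lemma limn_einf_le_cvg u v h (e : R) : u @ \oo --> h ->
  (\forall n \near \oo, v n <= u n + e%:E) -> limn_einf v <= h + e%:E.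
Proof.
move=> uh vu; have [<- _] := cvg_limn_einf_sup uh.
rewrite addeC -limn_einf_shift//; apply: le_limn_einf.
by move: vu; apply: filterS => n; rewrite addeC.
Qed.

Lemma rate_le (n : nat) x y (r e : R) : x <= y + r%:E -> (r <= n%:R * e)%R ->
  (0 < n)%N -> (n%:R^-1)%:E * x <= (n%:R^-1)%:E * y + e%:E.
Proof.
move=> xy re n0; have nR : (0 < n%:R :> R)%R by rewrite ltr0n.
apply: (@le_trans _ _ ((n%:R^-1)%:E * (y + r%:E))).
  by rewrite lee_wpmul2l// lee_fin invr_ge0 ltW.
rewrite muleDr//; last by rewrite fin_num_adde_defl.
rewrite leeD2l// -EFinM lee_fin mulrC ler_pdivrMr//.
by rewrite mulrC.
Qed.

Lemma ln_le_linear (s : nat) (e : R) : (0 < e)%R ->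
  \forall n \near \oo, (s%:R * ln n.+1%:R <= n%:R * e)%R.
Proof.
move=> e0; have s0 : (0 < s.+1%:R :> R)%R by rewrite ltr0n.
(* The bound [ln (dl * x) < dl * x] gives [ln] slope [dl] at the price of the constant [- ln dl].
   Here [s * dl <= e / 2], also for [s = 0], and [C] collects the terms that do not grow with
   [n]. *)
pose dl : R := (e / 2 / s.+1%:R)%R.
have dl0 : (0 < dl)%R by rewrite !divr_gt0.
pose C : R := (e / 2 + s%:R * `|ln dl|)%R.
near=> n.
have Cn : (C <= n%:R * (e / 2))%R.
  rewrite -ler_pdivrMr ?divr_gt0//.
  by near: n; exact: nbhs_infty_ger.
have h : (ln n.+1%:R <= dl * n.+1%:R - ln dl)%R.
  have : (ln (dl * n.+1%:R) < dl * n.+1%:R)%R.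
    by apply: ln_sublinear; rewrite mulr_gt0.
  by rewrite lnM ?posrE//; lra.
have sdl : (s%:R * dl <= e / 2)%R.
  rewrite /dl mulrCA ger_pMr ?divr_gt0// ler_pdivrMr// mul1r ler_nat//.
apply: (@le_trans _ _ (s%:R * (dl * n.+1%:R - ln dl))%R).
  by rewrite ler_wpM2l.
have a1 : (s%:R * dl * n.+1%:R <= e / 2 * n.+1%:R)%R by rewrite ler_wpM2r.
have a2 : (s%:R * - ln dl <= s%:R * `|ln dl|)%R.
  by rewrite ler_wpM2l// -normrN ler_norm.
rewrite mulrDr mulrA; apply: le_trans (lerD a1 a2) _.
rewrite -[(n.+1%:R)%R]natr1 mulrDr mulr1 [X in (X + _ + _)%R]mulrC -addrA.
by rewrite [X in (_ <= _ * X)%R](splitr e) mulrDr lerD2l.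
Unshelve. all: by end_near. Qed.

End limits.

Lemma labelH_cst d (X : measurableType d) (R : realType) (mu : probability X R)
    (A : Type) (f : X -> A) : (forall w w', f w = f w') -> labelH mu f = 0%E.
Proof.
move=> fc; rewrite /labelH; under eq_integral => w _.
  rewrite /info /pr (_ : _ @^-1` _ = setT) ?probability_setT ?ln1 ?oppr0; first over.
  by apply/seteqP; split => // w' _; exact: fc.
by rewrite integral0.
Qed.

Lemma entropy_labelH (R : realType) (mu : probability R R) (J : countType)
    (P : J -> set R) (f : R -> J) : mlabel f ->
  (forall j, mu (P j) = mu (f @^-1` [set j])) -> entropy mu P = labelH mu f.
Proof.
by move=> mf Pf; rewrite labelHE//; apply: eq_esum => j _; rewrite /pr Pf.
Qed.

(** * From the system on [Omega] to labels on the whole line *)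

Section conversion.
Context (R : realType) (Omega : set R) (mu : probability R R) (T : R -> R).
Hypothesis mOmega : measurable Omega.
Hypothesis mu_Omega : mu Omega = 1%E.
Hypothesis T_Omega : forall w, Omega w -> Omega (T w).
Hypothesis T_measurable : measurable_fun Omega T.
Hypothesis T_preserving : measure_preserving Omega mu T.
Hypothesis T_aperiodic : aperiodic Omega mu T.

Lemma mu_OmegaC : mu (~` Omega) = 0%E.
Proof. by rewrite probability_setC// mu_Omega subee. Qed.

Lemma mu_eq_off (N A B : set R) : measurable N -> measurable A ->
  measurable B -> mu N = 0%E -> (forall w, ~ N w -> A w <-> B w) -> mu A = mu B.
Proof.
move=> mN mA mB N0 AB; rewrite -(measureU0 mA mN N0) -(measureU0 mB mN N0).
congr (mu _); apply/seteqP; split => w [h|h]; try by right.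
  by have [Nw|/AB[]] := pselect (N w); [right|left; exact: a].
by have [Nw|/AB[]] := pselect (N w); [right|left; exact: b].
Qed.

(** Filling in the identity gives a measurable, measure-preserving map of the whole line with the
    same orbits inside [Omega]. *)
Definition ext w := if w \in Omega then T w else w.

Lemma extE w : Omega w -> ext w = T w.
Proof. by move=> Ow; rewrite /ext mem_set. Qed.

Lemma ext_Omega w : Omega w -> Omega (ext w).
Proof. by move=> Ow; rewrite extE//; exact: T_Omega. Qed.

Lemma iter_ext k w : Omega w -> iter k ext w = iter k T w.
Proof.
move=> Ow; elim: k => //= k IH; rewrite extE ?IH//.
exact: (Omega_iter T_Omega).
Qed.

Lemma measurable_ext : measurable_fun setT ext.
Proof.
move=> _ B mB; rewrite setTI.
rewrite [X in measurable X](_ : _ = (Omega `&` T @^-1` B) `|` (~` Omega `&` B)).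
  by apply: measurableU; [exact: T_measurable mOmega _ mB|
    apply: measurableI => //; exact: measurableC].
apply/seteqP; split => w; rewrite /preimage/= /ext.
  by have [Ow|Ow] := pselect (Omega w); [rewrite mem_set//; left|
    rewrite memNset//; right].
by move=> [[Ow]|[Ow]]; [rewrite mem_set|rewrite memNset].
Qed.

Lemma ext_preserving A : measurable A -> mu (ext @^-1` A) = mu A.
Proof.
move=> mA; have mE : measurable (ext @^-1` A).
  by rewrite -[_ @^-1` _]setTI; exact: measurable_ext.
have mOC := measurableC mOmega.
have mOA := measurableI _ _ mOmega mA.
transitivity (mu (Omega `&` T @^-1` (Omega `&` A))).
  apply: (mu_eq_off mOC) => //; [exact: T_measurable mOmega _ mOA|exact: mu_OmegaC|].
  move=> w /contrapT Ow; rewrite /preimage/= extE//.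
  by split => [Aw|[_ []]]//; split => //; split => //; exact: T_Omega.
rewrite T_preserving//.
apply: (mu_eq_off mOC) => //; first exact: mu_OmegaC.
by move=> w /contrapT Ow; split => [[]//|?]; split.
Qed.

Let per := [set w | Omega w /\ exists2 n, (0 < n)%N & iter n ext w = w].

Let mper : measurable per.
Proof.
have -> : per = \bigcup_(n in [set n | (0 < n)%N])
    (Omega `&` [set w | iter n ext w == w]).
  apply/seteqP; split => w; first by move=> [Ow [n n0 /eqP e]]; exists n.
  by move=> [n n0 [Ow /eqP e]]; split => //; exists n.
apply: bigcup_measurable => n _; apply: measurableI => //.
apply: (mlabel_bool _ [set b | b]); apply: measurable_fun_eqr.
  exact: (measurable_iter measurable_ext).
exact: measurable_id.
Qed.

Let mu_per : mu per = 0%E.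
Proof.
rewrite -[RHS]T_aperiodic; congr (mu _); apply/seteqP; split => w.
  by move=> [Ow [n n0 e]]; exists n => //; split => //; rewrite -iter_ext.
by move=> [n n0 [Ow e]]; split => //; exists n => //; rewrite iter_ext.
Qed.

(* Points outside [Omega] and points with an eventually periodic orbit. *)
Definition exceptional := ~` Omega `|` \bigcup_k (iter k ext @^-1` per).

Lemma measurable_exceptional : measurable exceptional.
Proof.
apply: measurableU; first exact: measurableC.
apply: bigcupT_measurable => k; rewrite -[_ @^-1` _]setTI.
exact: (measurable_iter measurable_ext).
Qed.

Lemma mu_exceptional : mu exceptional = 0%E.
Proof.
apply/negligibleP; first exact: measurable_exceptional.
apply: negligibleU.
  by apply/negligibleP; [exact: measurableC|exact: mu_OmegaC].
apply: negligible_bigcup => k; apply/negligibleP.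
  by rewrite -[_ @^-1` _]setTI; exact: (measurable_iter measurable_ext).
exact: etrans (mu_iter measurable_ext ext_preserving k mper) mu_per.
Qed.

Lemma pr_exceptional : pr mu exceptional = 0.
Proof. by rewrite /pr mu_exceptional. Qed.

Lemma exceptionalC : ~` exceptional `<=` Omega.
Proof. by move=> w h; apply: contrapT => Ow; apply: h; left. Qed.

(** A coincidence at times [i < j] would make the point at time [i] periodic with period [j - i]. *)
Lemma ext_inj w : ~ exceptional w -> injective (fun k => iter k ext w).
Proof.
move=> Nw; have Ow := exceptionalC Nw.
have lt i j : (i < j)%N -> iter i ext w <> iter j ext w.
  move=> ij e; apply: Nw; right; exists i => //; split.
    exact: (Omega_iter ext_Omega).
  by exists (j - i)%N; rewrite ?subn_gt0// -iterD subnK ?(ltnW ij).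
move=> i j e; have [ij|ji|//] := ltngtP i j; first by have := lt _ _ ij e.
by have := lt _ _ ji (esym e).
Qed.

Lemma nonempty_Omega : exists w, Omega w.
Proof.
apply: contrapT => h; move: mu_Omega; rewrite (_ : Omega = set0).
  by rewrite measure0 => /esym/eqP; rewrite onee_eq0.
by rewrite -subset0 => w Ow; apply: h; exists w.
Qed.

Lemma partition_label (I : countType) (P : I -> set R) :
  borel_partition Omega P ->
  exists2 p : R -> I, mlabel p & forall i, P i = Omega `&` p @^-1` [set i].
Proof.
move=> [[cov triv _] mP]; have [w0 Ow0] := nonempty_Omega.
have covP w : Omega w -> exists i, P i w.
  by rewrite -cov => -[i _ Pi]; exists i.
have PO i : P i `<=` Omega by move=> w Pw; rewrite -cov; exists i.
(* [i0] serves as the letter of all points outside [Omega]. *)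
have [i0 _] := covP w0 Ow0.
have /choice[p hp] w : exists i, if w \in Omega then P i w else i = i0.
  by case: (w \in Omega) / boolP => [/set_mem/covP|_]; [|exists i0].
have pP w : Omega w -> P (p w) w by move=> Ow; have := hp w; rewrite mem_set.
have Pp i w : P i w -> p w = i.
  move=> Pw; apply: triv => //; exists w; split => //.
  by apply: pP; exact: PO Pw.
exists p => [|i]; last first.
  apply/seteqP; split => w; first by move=> Pw; split; [exact: PO Pw|exact: Pp].
  by move=> [Ow <-]; exact: pP.
apply: mlabel_fiber => i.
rewrite [X in measurable X](_ : _ = P i `|` (~` Omega `&` [set _ | i0 = i])).
  apply: measurableU => //; apply: measurableI; first exact: measurableC.
  have [->|ne] := pselect (i0 = i).
    by rewrite [X in measurable X](_ : _ = setT)//; apply/seteqP; split.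
  by rewrite [X in measurable X](_ : _ = set0)//; rewrite -subset0.
apply/seteqP; split => w; rewrite /preimage/=.
  have [Ow <-|Ow <-] := pselect (Omega w); first by left; exact: pP.
  by right; split => //; have := hp w; rewrite memNset.
move=> [/Pp//|[Ow <-]]; by have := hp w; rewrite memNset.
Qed.

Lemma partition_entropyE (I : countType) (P : I -> set R) (p : R -> I) :
  mlabel p -> (forall i, P i = Omega `&` p @^-1` [set i]) ->
  (forall n, entropy mu (@refinement R Omega T I P n) =
    labelH mu (name ext p n)).
Proof.
move=> mp Pp n; have mE := measurable_ext.
pose phi (s : seq I) : n.-tuple I := [tuple nth (p 0) s k | k < n].
pose f w := phi (name ext p n w).
have fE w k : tnth (f w) k = p (iter k ext w).
  by rewrite /f /phi tnth_mktuple nth_mkseq.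
have mn := mlabel_name mE n mp.
have mf : mlabel f by exact: (mlabel_comp phi mn).
have -> : labelH mu (name ext p n) = labelH mu f.
  apply/eqP; rewrite eq_le; apply/andP; split.
    apply: labelH_le => // w w' e; apply: (@eq_from_nth _ (p 0)).
      by rewrite !size_mkseq.
    move=> k; rewrite size_mkseq => kn.
    by rewrite !nth_mkseq// -!(fE _ (Ordinal kn)) e.
  by apply: labelH_le => // w w' e; rewrite /f e.
apply: entropy_labelH => // t.
have -> : refinement Omega T P t = Omega `&` f @^-1` [set t].
  apply/seteqP; split => w [Ow h]; split => //.
    apply: eq_from_tnth => k; rewrite fE.
    by have := h k; rewrite Pp iter_ext// => -[].
  move=> k; rewrite Pp; split; first by apply: Omega_iter.
  by rewrite /preimage/= -h fE iter_ext.
apply: (mu_eq_off (measurableC mOmega)) => //.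
- by apply: measurableI => //; exact: mf.
- exact: mu_OmegaC.
- by move=> w /contrapT Ow; split => [[]//|?]; split.
Qed.

Lemma partition_entropy_cvg (I : countType) (P : I -> set R) (p : R -> I) :
  mlabel p -> (forall i, P i = Omega `&` p @^-1` [set i]) ->
  (entropy mu P < +oo)%E ->
  labelH mu p = entropy mu P /\
  ((n%:R^-1)%:E * labelH mu (name ext p n))%E @[n --> \oo] -->
    partition_entropy Omega mu T P.
Proof.
move=> mp Pp; have mE := measurable_ext.
have HP : entropy mu P = labelH mu p.
  apply: entropy_labelH => // i; rewrite Pp.
  apply: (mu_eq_off (measurableC mOmega)) => //.
  - by apply: measurableI => //; exact: mp.
  - exact: mu_OmegaC.
  - by move=> w /contrapT Ow; split => [[]//|?]; split.
rewrite HP => fin; split => //; rewrite /partition_entropy.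
under [X in _ --> limn X]eq_fun do rewrite (partition_entropyE mp Pp).
exact: (name_rate_cvg mE ext_preserving mp fin).
Qed.

(** Off the exceptional set the orbit points are distinct, so the comparison matrix has exactly one
    sorting permutation; conversely, the matrix is read off from the positions of the indices in the
    sorted list. *)
Lemma ordinal_entropyE n :
  entropy mu (@ordinal_set R Omega T n) = labelH mu (cmp ext n).
Proof.
have mE := measurable_ext.
pose e (c : seq (seq bool)) : rel 'I_n := fun i j => nth false (nth [::] c i) j.
pose srt c (pi : 'S_n) := sorted (e c) [seq pi k | k <- enum 'I_n].
(* The default is never taken on the matrix of an actual orbit, since sorting provides a
   permutation. *)
pose phi c : 'S_n := odflt 1%g [pick pi | srt c pi].
pose g w := phi (cmp ext n w).
have eE w : e (cmp ext n w) =2 (fun i j : 'I_n => iter i ext w <= iter j ext w).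
  by move=> i j; rewrite /e nth_cmp.
have e_trans w : transitive (e (cmp ext n w)).
  by move=> j i k; rewrite !eE; exact: le_trans.
have e_refl w : reflexive (e (cmp ext n w)) by move=> i; rewrite eE.
have e_total w : total (e (cmp ext n w)) by move=> i j; rewrite !eE le_total.
have e_anti w : ~ exceptional w -> antisymmetric (e (cmp ext n w)).
  move=> Nw i j; rewrite !eE => /le_anti /(ext_inj Nw) ij; exact: val_inj.
have perm_pi (pi : 'S_n) : perm_eq [seq pi k | k <- enum 'I_n] (enum 'I_n).
  apply: uniq_perm; last 2 first.
  - exact: enum_uniq.
  - move=> i; rewrite mem_enum inE; apply/mapP; exists (pi^-1%g i).
      by rewrite mem_enum.
    by rewrite permKV.
  by rewrite map_inj_uniq ?enum_uniq//; exact: perm_inj.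
have srt_ex w : exists pi, srt (cmp ext n w) pi.
  have /tuple_permP[pi ep] : perm_eq (sort (e (cmp ext n w)) (ord_tuple n)) (ord_tuple n).
    by rewrite perm_sort.
  exists pi; rewrite /srt.
  have -> : [seq pi k | k <- enum 'I_n] = sort (e (cmp ext n w)) (ord_tuple n).
    rewrite ep /= ; apply: eq_map => k; by rewrite tnth_ord_tuple.
  exact: sort_sorted.
have srt_g w : srt (cmp ext n w) (g w).
  rewrite /g /phi; case: pickP => //= none.
  by have [pi] := srt_ex w; rewrite none.
have srt_uniq w pi pi' : ~ exceptional w -> srt (cmp ext n w) pi ->
    srt (cmp ext n w) pi' -> pi = pi'.
  move=> Nw s s'.
  have /eq_in_map eqpi := sorted_eq (e_trans w) (e_anti w Nw) s s'
    (perm_trans (perm_pi pi) (etrans (perm_sym _ _) (perm_pi pi'))).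
  by apply/permP => i; apply: eqpi; rewrite mem_enum.
have mc := mlabel_cmp mE n.
have mg : mlabel g by exact: (mlabel_comp phi mc).
have -> : labelH mu (cmp ext n) = labelH mu g.
  apply/eqP; rewrite eq_le; apply/andP; split; last first.
    by apply: labelH_le => // w w' ec; rewrite /g ec.
  apply: (labelH_le_ae mc mg measurable_exceptional pr_exceptional).
  move=> w w' Nw Nw' ge; apply/cmpP => i j i_n jn.
  pose s := [seq g w k | k <- enum 'I_n].
  have mems i' : i' \in s by rewrite (perm_mem (perm_pi _)) mem_enum.
  have leE v : ~ exceptional v -> sorted (e (cmp ext n v)) s ->
      (iter i ext v <= iter j ext v) =
      (index (Ordinal i_n) s <= index (Ordinal jn) s)%N.
    move=> Nv sv; rewrite -(eE v (Ordinal i_n) (Ordinal jn)).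
    have idx := sorted_leq_index (e_trans v) (e_refl v) sv.
    apply/idP/idP => [eij|]; last exact: idx.
    rewrite leqNgt; apply/negP => ji.
    have eji := idx _ _ (mems _) (mems _) (ltnW ji).
    have ij : Ordinal i_n = Ordinal jn by apply: (e_anti v Nv); rewrite eij eji.
    by move: ji; rewrite ij ltnn.
  rewrite !leE//; first by rewrite /s ge; exact: srt_g.
  exact: srt_g.
have ordE pi : ordinal_set Omega T pi =
    Omega `&` cmp ext n @^-1` [set c | srt c pi].
  have sE w : Omega w -> sorted <=%R [seq iter (pi k) T w | k <- enum 'I_n] =
      srt (cmp ext n w) pi.
    move=> Ow; rewrite /srt !sorted_map; apply: eq_sorted => k l /=.
    by rewrite eE !iter_ext.
  apply/seteqP; split => w [Ow h]; split => //.
    by rewrite /preimage/= -sE.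
  by rewrite sE.
apply: entropy_labelH => // pi; rewrite ordE.
apply: (mu_eq_off measurable_exceptional).
- by apply: measurableI => //; exact: mc.
- exact: mg.
- exact: mu_exceptional.
- move=> w Nw; split => [[Ow h]|gw].
    by apply: (srt_uniq w) => //; exact: srt_g.
  split; first exact: exceptionalC.
  by rewrite /preimage/= -gw; exact: srt_g.
Qed.

(** Half of [e] pays for replacing the partition by a threshold partition, the other half for the
    logarithmic cost of the counts. *)
Lemma KS_le_permutation : (KS_entropy Omega mu T <= permutation_entropy Omega mu T)%E.
Proof.
have mE := measurable_ext; have pE := ext_preserving.
apply: ge_ereal_sup => _ [I [P [bP HP ->]]].
have [p mp Pp] := partition_label bP.
have [Hp cvgp] := partition_entropy_cvg mp Pp HP.
apply: cvg_le_limn_einf cvgp _ => e e0.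
have e2 : 0 < e / 2 by lra.
have Hpfin : (labelH mu p < +oo)%E by rewrite Hp.
have [beta beta0 hbeta] := labelH_name_approx mE pE mp Hpfin e2.
have [c [psi hc]] := cut_label mu mp beta0.
have := ln_le_linear (size c) e2.
apply: filterS2 (nbhs_infty_gt 0) => n n0 hln.
rewrite ordinal_entropyE.
apply: (@rate_le _ _ _ _ ((size c)%:R * ln n.+1%:R + n%:R * (e / 2))) => //; last first.
  by rewrite {2}(splitr e) mulrDr lerD2r.
apply: le_trans (hbeta _ [::] (cut c) psi (mlabel_cut c) hc n) _.
by rewrite EFinD addeA leeD2r// labelH_cut_le_cmp.
Qed.

Lemma permutation_le_KS (I : countType) (M : I -> set R) :
  monotony_partition Omega T M -> (entropy mu M < +oo)%E ->
  (permutation_entropy Omega mu T <= KS_entropy Omega mu T)%E.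
Proof.
move=> [bM monoM] HM; have mE := measurable_ext; have pE := ext_preserving.
have [m mm Mm] := partition_label bM.
have [Hm _] := partition_entropy_cvg mm Mm HM.
have cell_interval i : is_interval [set w | Omega w /\ m w = i].
  by have [+ _] := monoM i; rewrite Mm.
have cell_monotone i : monotone_on [set w | Omega w /\ m w = i] ext.
  have [_] := monoM i; rewrite Mm => -[] mono; [left|right];
    by move=> x y [Ox mx] [Oy my] xy; rewrite !extE//; exact: mono.
apply/lee_addgt0Pr => e e0.
have ln20 : 0 < ln 2 :> R by rewrite ln_gt0// ltr1n.
(* Each tie bit costs [ln 2], so a recurrence rate of [e / ln 2] yields [e]. *)
have e2 : 0 < e / ln 2 by rewrite divr_gt0.
have [c [n0 hc]] := cut_recurrence mE pE measurable_exceptional pr_exceptional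
  ext_inj e2.
pose p w := (m w, cut c w).
have mp : mlabel p by apply: mlabel_pair => //; exact: mlabel_cut.
have Hp : (labelH mu p < +oo)%E.
  apply: le_lt_trans (labelH_pair _ mm (mlabel_cut c)) _.
  apply: lte_add_pinfty; first by rewrite Hm.
  (* A cut has finite entropy by the counting bound at length 1, where the comparison matrix is
     constant. *)
  apply: le_lt_trans (_ : labelH mu (name ext (cut c) 1) < +oo)%E.
    apply: labelH_le; [exact: mlabel_cut|
      by apply: mlabel_name => //; exact: mlabel_cut|].
    by move=> w w' [].
  apply: le_lt_trans (labelH_cut_le_cmp mu mE c 1) _.
  by rewrite labelH_cst ?add0e ?ltry// => w w'; rewrite /cmp /mkseq /= !lexx.
(* A partition must have nonempty cells, so only the letters that occur in [Omega] are kept; [j0] is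
   the default elsewhere. *)
pose J := {x : I * seq bool | `[< exists2 w, Omega w & p w = x >]}.
have memJ w : Omega w -> `[< exists2 w', Omega w' & p w' = p w >].
  by move=> Ow; apply/asboolP; exists w.
have [w0 Ow0] := nonempty_Omega.
pose j0 : J := exist _ (p w0) (memJ _ Ow0).
pose q w : J := insubd j0 (p w).
have qE w : Omega w -> val (q w) = p w.
  by move=> Ow; rewrite /q val_insubd memJ.
have mq : mlabel q by exact: (mlabel_comp (insubd j0) mp).
pose Q (j : J) := Omega `&` q @^-1` [set j].
have bQ : borel_partition Omega Q.
  split; last by move=> j; apply: measurableI => //; exact: mq.
  split.
  - apply/seteqP; split => w; first by move=> [j _ []].
    by move=> Ow; exists (q w).
  - by move=> i j _ _ [w [[_ <-] [_ <-]]].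
  - move=> [x xJ] _; have /asboolP[w Ow pw] := xJ.
    by exists w; split => //; apply: val_inj; rewrite /= qE.
have HQ : (entropy mu Q < +oo)%E.
  rewrite (@entropy_labelH _ _ _ _ q)//.
    apply: le_lt_trans Hp; apply: labelH_le => // w w' e'.
    by rewrite /q e'.
  move=> j; apply: (mu_eq_off (measurableC mOmega)) => //.
  - by apply: measurableI => //; exact: mq.
  - exact: mu_OmegaC.
  - by move=> w /contrapT Ow; split => [[]//|?]; split.
have [_ cvgq] := partition_entropy_cvg mq (fun=> erefl) HQ.
apply: (@le_trans _ _ (partition_entropy Omega mu T Q + e%:E)%E); last first.
  by rewrite leeD2r//; apply: ereal_sup_ubound; exists J, Q.
apply: limn_einf_le_cvg cvgq _.
near=> n.
have n1 : (0 < n)%N by near: n; exact: nbhs_infty_gt.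
have nn0 : (n0 <= n)%N by near: n; exact: nbhs_infty_ge.
rewrite ordinal_entropyE.
have mlast : mlabel (fun w => cut c (iter n.-1 ext w)).
  by apply: mlabel_iter => //; exact: mlabel_cut.
have := hc n _ mlast nn0.
move=> /(ler_wpM2l (ltW ln20)); rewrite mulrCA [ln 2 * (_ / _)]mulrC divfK ?gt_eqF//.
move=> hsum; apply: (rate_le _ hsum n1).
apply: le_trans (labelH_cmp_le mE measurable_exceptional pr_exceptional
  exceptionalC ext_Omega ext_inj mm cell_interval cell_monotone c n) _.
rewrite leeD2r//.
apply: (labelH_le_ae _ _ measurable_exceptional pr_exceptional).
- exact: mlabel_name.
- exact: mlabel_name.
move=> w w' Nw Nw' enm; apply: (@eq_from_nth _ (p 0)); rewrite ?size_mkseq// => k kn.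
have := congr1 (fun s => nth j0 s k) enm; rewrite /name !nth_mkseq//.
move=> /(congr1 val); rewrite !qE//; apply: (Omega_iter ext_Omega); exact: exceptionalC.
Unshelve. all: by end_near. Qed.

End conversion.

Theorem theorem2 (R : realType) (Omega : set R) (mu : probability R R)
    (T : R -> R) (I : countType) (M : I -> set R)
    (Omega_compact : compact Omega)
    (mu_Omega : mu Omega = 1%E)
    (T_Omega : forall w, Omega w -> Omega (T w))
    (T_measurable : measurable_fun Omega T)
    (T_preserving : measure_preserving Omega mu T)
    (T_aperiodic : aperiodic Omega mu T)
    (M_monotony : monotony_partition Omega T M)
    (M_entropy : (entropy mu M < +oo)%E) :
  permutation_entropy Omega mu T = KS_entropy Omega mu T.
Proof.
have mOmega := compact_measurable Omega_compact.
apply/eqP; rewrite eq_le; apply/andP; split.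
  exact: permutation_le_KS M_monotony M_entropy.
exact: KS_le_permutation.
Qed.
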